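(* Let $G$ be a group and let $X$ be a simplicial $G$-CW-complex. Suppose that the following hold: (i) $X$ is simply-connected; (ii) the quotient $G\backslash X^{(3)}$ of the $3$-skeleton is compact; (iii) all stabilisers of $2$-simplices of $X$ are finitely generated; (iv) all stabilisers of $1$-simplices of $X$ are finitely presented; (v) for every $0$-simplex $v$ of $X$, every connected component of the link of $v$ in $X$ is simply-connected; (vi) $G$ is finitely presented. Then all stabilisers of $0$-simplices of $X$ are finitely presented.
   Context: Groups are discrete. $G$-CW-complexes are understood in the usual sense: $G$ permutes the open cells, and an element of $G$ mapping a cell to itself fixes that cell pointwise. A simplicial $G$-CW-complex is a $G$-CW-complex whose underlying CW-complex is a simplicial complex. The stabiliser of a cell (simplex) $\sigma$ is $G_\sigma=\{g\in G\mid g\sigma=\sigma\}$. $X^{(k)}$ denotes the $k$-skeleton of $X$. The link of a vertex $v$ in a simplicial complex is the subcomplex of all simplices not containing $v$ that together with $v$ span a simplex of the complex. Simply-connected includes connected. *)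

(* Defs.v *)
From HB Require Import structures.
From mathcomp Require Import all_boot all_order all_algebra.
From mathcomp Require Import generic_quotient finmap.
From mathcomp Require Import all_classical all_reals all_analysis.

Set Implicit Arguments.
Unset Strict Implicit.
Unset Printing Implicit Defensive.

Import Order.TTheory GRing.Theory Num.Theory.
Import numFieldNormedType.Exports.

Local Open Scope classical_set_scope.
Local Open Scope ring_scope.
Local Open Scope quotient_scope.

(* The letter (i, true) is the generator i, and (i, false) is its inverse. *)
Definition word (n : nat) := seq ('I_n * bool).

Definition word_eval (G : groupType) (n : nat) (x : 'I_n -> G) (w : word n) : G :=
  foldr (fun l a => (if l.2 then x l.1 else (x l.1)^-1) * a)%g 1%g w.

(* Equality of words in the presented group < 'I_n | rels >: the smallest
   congruence on words that cancels inverse letters and trivialises [rels]. *)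
Inductive pres_eq (n : nat) (rels : seq (word n)) : word n -> word n -> Prop :=
| pres_refl w : pres_eq rels w w
| pres_sym w1 w2 : pres_eq rels w1 w2 -> pres_eq rels w2 w1
| pres_trans w1 w2 w3 :
    pres_eq rels w1 w2 -> pres_eq rels w2 w3 -> pres_eq rels w1 w3
| pres_cancel u v (i : 'I_n) (b : bool) :
    pres_eq rels (u ++ (i, b) :: (i, ~~ b) :: v) (u ++ v)
| pres_rel u v r : r \in rels -> pres_eq rels (u ++ r ++ v) (u ++ v).

Definition finitely_generated (G : groupType) (H : set G) : Prop :=
  exists (n : nat) (x : 'I_n -> G), range (word_eval x) = H.

(* Evaluation of words induces an isomorphism < 'I_n | rels > -> H. *)
Definition finitely_presented (G : groupType) (H : set G) : Prop :=
  exists (n : nat) (x : 'I_n -> G) (rels : seq (word n)),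
    range (word_eval x) = H /\
    forall w1 w2, word_eval x w1 = word_eval x w2 <-> pres_eq rels w1 w2.

Section SimplyConnected.
Variables (R : realType) (T : topologicalType).

Definition path_connected : Prop :=
  forall x y : T, exists f : R -> T,
    [/\ {within `[0, 1], continuous f}, f 0 = x & f 1 = y].

Definition null_homotopic (f : R -> T) : Prop :=
  exists H : R * R -> T,
    [/\ {within `[0, 1] `*` `[0, 1], continuous H},
        forall t, t \in `[0, 1] -> H (0, t) = f t,
        forall t, t \in `[0, 1] -> H (1, t) = f 0 &
        forall s, s \in `[0, 1] -> H (s, 0) = f 0 /\ H (s, 1) = f 0].

Definition simply_connected : Prop :=
  [/\ [set: T] !=set0, path_connected &
      forall f : R -> T, {within `[0, 1], continuous f} -> f 0 = f 1 ->
        null_homotopic f].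

End SimplyConnected.

(* A point v : V is a vertex only if [fset v] is a simplex. *)
Record scomplex (V : choiceType) := SComplex {
  simplex :> {fset V} -> Prop;
  simplex_neq0 : forall s, simplex s -> s != fset0;
  simplex_face : forall s t, simplex s -> (t `<=` s)%fset -> t != fset0 -> simplex t
}.

Section Link.
Local Open Scope fset_scope.
Variables (V : choiceType) (K : scomplex V) (v : V).

Definition link_simplex (s : {fset V}) : Prop :=
  [/\ K s, v \notin s & K (v |` s)].

Lemma link_simplex_neq0 s : link_simplex s -> s != fset0.
Proof. by case=> Ks _ _; exact: simplex_neq0 Ks. Qed.

Lemma link_simplex_face s t :
  link_simplex s -> t `<=` s -> t != fset0 -> link_simplex t.
Proof.
case=> Ks vs Kvs ts t0; split.
- exact: simplex_face Ks ts t0.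
- by apply: contra vs; apply: (fsubsetP ts).
- apply: simplex_face Kvs (fsetUS _ ts) _.
  by apply/fset0Pn; exists v; rewrite !inE eqxx.
Qed.

Definition link : scomplex V := SComplex link_simplex_neq0 link_simplex_face.

End Link.

(* Points are given by their barycentric coordinates. *)
Record realization (R : realType) (V : choiceType) (K : scomplex V) := RPoint {
  coord :> V -> R;
  coord_ge0 : forall v, 0 <= coord v;
  coord_supp : exists s, [/\ K s, forall v, (v \in s) = (0 < coord v) &
                             \sum_(v <- s) coord v = 1]
}.

Section Realization.
Variables (R : realType) (V : choiceType) (K : scomplex V).
Local Notation "|K|" := (realization R K).

Definition open_cell (s : {fset V}) : set |K| :=
  [set x | forall v, (v \in s) = (0 < x v)].

Definition closed_cell (s : {fset V}) : set |K| :=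
  [set x | forall v, 0 < x v -> v \in s].

(* The weak topology: U is open iff its trace on every closed simplex is open
   for the Euclidean topology of that simplex. *)
Definition weak_open (U : set |K|) : Prop :=
  forall s, K s -> forall x, closed_cell s x -> U x ->
    exists2 e : R, 0 < e & forall y, closed_cell s y ->
      (forall v, v \in s -> `|x v - y v| < e) -> U y.

Lemma weak_openT : weak_open setT.
Proof. by move=> s _ x _ _; exists 1. Qed.

Lemma weak_openI : setI_closed weak_open.
Proof.
move=> A B oA oB s Ks x xs [Ax Bx].
have [e e0 eA] := oA s Ks x xs Ax; have [d d0 dB] := oB s Ks x xs Bx.
exists (Num.min e d) => [|y ys xy]; first by rewrite lt_min e0.
by split; [apply: eA => // v /xy | apply: dB => // v /xy];
  rewrite lt_min => /andP[].
Qed.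

Lemma weak_open_bigU (I : Type) (f : I -> set |K|) :
  (forall i, weak_open (f i)) -> weak_open (\bigcup_i f i).
Proof.
move=> of_ s Ks x xs [i _ fix_]; have [e e0 ef] := of_ i s Ks x xs fix_.
by exists e => // y ys xy; exists i => //; exact: ef.
Qed.

HB.instance Definition _ := gen_eqMixin |K|.
HB.instance Definition _ := gen_choiceMixin |K|.
HB.instance Definition _ :=
  isOpenTopological.Build |K| weak_openT weak_openI weak_open_bigU.

Definition skeleton (k : nat) : set |K| :=
  [set x | exists2 s, K s /\ (#|` s| <= k.+1)%N & open_cell s x].

End Realization.
Arguments open_cell {R V K}.
Arguments closed_cell {R V K}.
Arguments skeleton {R V}.

(* The action is only required to be by homeomorphisms permuting the open
   cells; it need not be affine on simplices. *)
Record simplicialGCW (R : realType) (G : groupType) (V : choiceType) := GCW {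
  gcw_complex :> scomplex V;
  act : G -> realization R gcw_complex -> realization R gcw_complex;
  act1 : forall x, act 1%g x = x;
  actM : forall g h x, act (g * h)%g x = act g (act h x);
  act_continuous : forall g, continuous (act g);
  act_cell : forall g s, gcw_complex s ->
    exists2 t, gcw_complex t & act g @` open_cell s = open_cell t;
  act_fix : forall g s, gcw_complex s ->
    act g @` open_cell s = open_cell s -> forall x, open_cell s x -> act g x = x
}.

Arguments act {R G V} X : rename.

Section GCWTheory.
Variables (R : realType) (G : groupType) (V : choiceType).
Variable X : simplicialGCW R G V.

Definition stabiliser (s : {fset V}) : set G :=
  [set g | act X g @` open_cell s = open_cell s].

Section OrbitSpace.
Variable A : set (realization R X).

Definition orbit_rel (x y : A) : bool :=
  `[< exists g : G, act X g (set_val x) = set_val y >].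

Lemma orbit_rel_refl : reflexive orbit_rel.
Proof. by move=> x; apply/asboolP; exists 1%g; rewrite act1. Qed.

Lemma orbit_rel_sym : symmetric orbit_rel.
Proof.
suff H x y : orbit_rel x y -> orbit_rel y x by move=> x y; apply/idP/idP; exact: H.
move=> /asboolP[g gx]; apply/asboolP; exists g^-1%g.
by rewrite -gx -actM mulVg act1.
Qed.

Lemma orbit_rel_trans : transitive orbit_rel.
Proof.
move=> y x z /asboolP[g gx] /asboolP[h hy]; apply/asboolP; exists (h * g)%g.
by rewrite actM gx.
Qed.

Canonical orbit_equiv := EquivRel orbit_rel orbit_rel_refl orbit_rel_sym orbit_rel_trans.

(* The quotient G\A of the subspace A (used for G-invariant A). *)
Definition orbit_space := quotient_topology {eq_quot orbit_equiv}.

Definition cocompact : Prop := compact [set: orbit_space].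

End OrbitSpace.

End GCWTheory.
Arguments stabiliser {R G V} X.
Arguments orbit_space {R G V} X.
Arguments cocompact {R G V} X.

(* Main.v *)
Require Import Defs.
From HB Require Import structures.
From mathcomp Require Import all_boot all_order all_algebra.
From mathcomp Require Import perm generic_quotient finmap.
From mathcomp Require Import all_classical all_reals all_analysis lra ring.

Set Implicit Arguments.
Unset Strict Implicit.
Unset Printing Implicit Defensive.

Local Open Scope classical_set_scope.

(** Let A be the stabiliser of a vertex v0, and L the link of v0. A retract of
    a finitely presented group is finitely presented ([fp_retract]), so it is
    enough to find a finitely presented group P with a homomorphism p to A and a
    section rho of p. On the way to P one may freely add generators lying over given
    elements of A, and kill finitely many elements of the kernel of p.

    The link provides P. Were L connected, A would have a presentation of Brown's
    type: stabilisers in A of representatives of the vertices of L (stabilisers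
    of edges of X, so finitely presented), a generator for each orbit of edges of
    L, relations for the generators of the stabilisers of these (stabilisers of
    triangles of X, so finitely generated) and a relation for each orbit of
    triangles. For disconnected L the same recipe still gives a finitely
    presented P over A in which every element g of A has a lift lam g C for each
    component C of L, multiplicative in the sense
    lam (g h) C = lam g (h C) lam h C. The new generators are a P-valued cocycle
    on the edges of L; as the components of L are simply connected it is a
    coboundary, and dividing the lifts by it makes them constant on components
    ([fp_over_link]).

    Since X is simply connected, it is a tree-like union of pieces glued at the
    vertices: a component of X minus w meets only one component of the link of w
    ([off_conn_link]). Hence, seen from w in the orbit of v0, any other vertex u
    lies in a definite direction, namely a component of the link of w, and every
    g in G has a lift mu g w u in P which depends only on the direction of u
    ([vertex_cocycle]). Let a generator x of G act at w by its lift in the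
    direction of v0. This is compatible with products except at the finitely many
    w that separate v0 from its translate by x, where a new generator of P is
    used. A word in the generators then acts at all but finitely many w by the
    lift of the element it spells, so a relator of G acts by 1 at all but finitely
    many w, and the remaining values may be killed in P. After that the lifts at
    w = v0 depend only on the element of G, and on A they form the section rho
    ([stab_fp_of_link]). So finite presentation of G enters twice: finitely many
    generators of P are added, and finitely many relators.

    Apart from connectedness of X, simple connectivity is used in the form that a
    cocycle on the edges with values in any group is a coboundary ([cocycle_trivial]). It follows from null
    homotopies by cutting the square into small squares that are mapped into open
    stars of vertices ([hol_null], [cocycle_trivial_of_null]). The action by
    homeomorphisms permuting the cells induces a simplicial action on the vertices
    because open cells are dense in closed ones ([vact_action], [cell_image],
    [stabiliserE]), and compactness of the quotient leaves only finitely many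
    orbits of cells because choosing one point in each cell, equivariantly, gives
    a discrete set ([finite_orbits]). *)

(** * Presented groups *)

Section PresentedGroup.
Local Open Scope group_scope.
Local Open Scope quotient_scope.

Definition winv n (w : word n) : word n := rev [seq (l.1, ~~ l.2) | l <- w].

Section WordEval.
Variables (G : groupType) (n : nat) (x : 'I_n -> G).

Lemma word_eval_cat w1 w2 :
  word_eval x (w1 ++ w2) = word_eval x w1 * word_eval x w2.
Proof. by elim: w1 => [|l w1 IH] /=; rewrite ?mul1g // IH mulgA. Qed.

Lemma word_eval1 l : word_eval x [:: l] = if l.2 then x l.1 else (x l.1)^-1.
Proof. by rewrite /= mulg1. Qed.

Lemma word_eval_inv w : word_eval x (winv w) = (word_eval x w)^-1.
Proof.
elim: w => [|l w IH]; first by rewrite invg1.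
rewrite /winv map_cons rev_cons -cats1 word_eval_cat -/(winv w) IH word_eval1.
by rewrite /= invgM; case: l.2; rewrite ?invgK.
Qed.

Lemma pres_eq_sound rels w1 w2 :
  (forall r, r \in rels -> word_eval x r = 1) ->
  pres_eq rels w1 w2 -> word_eval x w1 = word_eval x w2.
Proof.
move=> relP; elim=> {w1 w2} // [w1 w2 w3 _ -> _ -> //|u v i b|u v r /relP r1].
  by rewrite !word_eval_cat /=; case: b; rewrite /= ?mulVKg ?mulKg.
by rewrite !word_eval_cat r1 mul1g.
Qed.

End WordEval.

Section PresEq.
Variables (n : nat) (rels : seq (word n)).
Implicit Types u v w : word n.

Lemma pres_eq_ctx u v w1 w2 :
  pres_eq rels w1 w2 -> pres_eq rels (u ++ w1 ++ v) (u ++ w2 ++ v).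
Proof.
elim=> {w1 w2} [w|w1 w2 _|w1 w2 w3 _ + _|u' v' i b|u' v' r rin].
- exact: pres_refl.
- exact: pres_sym.
- exact: pres_trans.
- by have := pres_cancel rels (u ++ u') (v' ++ v) i b; rewrite -!catA.
- by have := pres_rel (u ++ u') (v' ++ v) rin; rewrite -!catA.
Qed.

Lemma pres_eq_cat u1 u2 w1 w2 :
  pres_eq rels u1 u2 -> pres_eq rels w1 w2 -> pres_eq rels (u1 ++ w1) (u2 ++ w2).
Proof.
move=> hu hw; apply: (@pres_trans _ _ _ (u2 ++ w1)).
  exact: (pres_eq_ctx [::] w1 hu).
by have := pres_eq_ctx u2 [::] hw; rewrite !cats0.
Qed.

Lemma pres_eq_mulV w : pres_eq rels (w ++ winv w) [::].
Proof.
elim: w => [|[i b] w IH]; first exact: pres_refl.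
rewrite /winv map_cons rev_cons -cats1 -/(winv w) cat_cons catA.
apply: (@pres_trans _ _ _ [:: (i, b); (i, ~~ b)]).
  exact: (pres_eq_ctx [:: (i, b)] [:: (i, ~~ b)] IH).
exact: (pres_cancel rels [::] [::] i b).
Qed.

Lemma winvK w : winv (winv w) = w.
Proof.
rewrite /winv map_rev revK -map_comp -[RHS]map_id; apply: eq_map => -[i b] /=.
by rewrite negbK.
Qed.

Lemma pres_eq_Vmul w : pres_eq rels (winv w ++ w) [::].
Proof. by rewrite -{2}[w]winvK; exact: pres_eq_mulV. Qed.

Lemma pres_eq_winv w1 w2 :
  pres_eq rels w1 w2 -> pres_eq rels (winv w1) (winv w2).
Proof.
move=> h12; apply: (@pres_trans _ _ _ (winv w1 ++ w2 ++ winv w2)).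
  rewrite -[X in pres_eq _ X _]cats0; apply: pres_eq_cat; first exact: pres_refl.
  exact/pres_sym/pres_eq_mulV.
apply: (@pres_trans _ _ _ (winv w1 ++ w1 ++ winv w2)).
  exact: pres_eq_ctx (pres_sym h12).
rewrite catA -[X in pres_eq _ _ X]cat0s.
by apply: pres_eq_cat; [exact: pres_eq_Vmul | exact: pres_refl].
Qed.

Definition pres_eqb : rel (word n) := fun w1 w2 => `[< pres_eq rels w1 w2 >].

Lemma pres_eqb_refl : reflexive pres_eqb.
Proof. by move=> w; apply/asboolP; exact: pres_refl. Qed.

Lemma pres_eqb_sym : symmetric pres_eqb.
Proof. by move=> v w; apply/asboolP/asboolP => ?; exact: pres_sym. Qed.

Lemma pres_eqb_trans : transitive pres_eqb.
Proof. by move=> v u w /asboolP uv /asboolP vw; apply/asboolP; exact: pres_trans uv vw. Qed.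

Canonical pres_equiv := EquivRel pres_eqb pres_eqb_refl pres_eqb_sym pres_eqb_trans.

Definition pgroup := {eq_quot pres_equiv}.

HB.instance Definition _ := Choice.on pgroup.
HB.instance Definition _ := EqQuotient.on pgroup.

Definition pclass (w : word n) : pgroup := \pi w.
Definition pword (a : pgroup) : word n := repr a.

Lemma pclassP w1 w2 : pclass w1 = pclass w2 <-> pres_eq rels w1 w2.
Proof.
by split=> [/eqmodP /asboolP //|h]; apply/eqmodP/asboolP.
Qed.

Lemma pwordK a : pclass (pword a) = a.
Proof. exact: reprK. Qed.

Lemma pword_class w : pres_eq rels (pword (pclass w)) w.
Proof. by apply/pclassP; rewrite pwordK. Qed.

Let pmul (a b : pgroup) : pgroup := pclass (pword a ++ pword b).
Let pinv (a : pgroup) : pgroup := pclass (winv (pword a)).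
Let pone : pgroup := pclass [::].

Let pmul_class u v : pmul (pclass u) (pclass v) = pclass (u ++ v).
Proof. by apply/pclassP/pres_eq_cat; exact: pword_class. Qed.

Let pinv_class w : pinv (pclass w) = pclass (winv w).
Proof. by apply/pclassP/pres_eq_winv; exact: pword_class. Qed.

Let pmulA : associative pmul.
Proof.
by move=> a b c; rewrite -(pwordK a) -(pwordK b) -(pwordK c) !pmul_class catA.
Qed.

Let pmul1 : left_id pone pmul.
Proof. by move=> a; rewrite -(pwordK a) pmul_class. Qed.

Let pmulr1 : right_id pone pmul.
Proof. by move=> a; rewrite -(pwordK a) pmul_class cats0. Qed.

Let pmulV : left_inverse pone pinv pmul.
Proof.
move=> a; rewrite -(pwordK a) pinv_class pmul_class; apply/pclassP.
exact: pres_eq_Vmul.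
Qed.

Let pmulrV : right_inverse pone pinv pmul.
Proof.
move=> a; rewrite -(pwordK a) pinv_class pmul_class; apply/pclassP.
exact: pres_eq_mulV.
Qed.

HB.instance Definition _ :=
  isGroup.Build pgroup pmulA pmul1 pmulr1 pmulV pmulrV.

End PresEq.
End PresentedGroup.

(** In a product associated to the left, cancelling factors become adjacent. *)
Ltac gsimp := rewrite ?(invgM, invgK, mulgA, mulgK, mulgVK, mulVg, mulgV,
  mulg1, mul1g, invg1).

(** * Finitely presented groups over a subgroup *)

Section Over.
Local Open Scope group_scope.

Definition mulhom (P Q : groupType) (f : P -> Q) := {morph f : a b / a * b}.

Lemma mulhom1 (P Q : groupType) (f : P -> Q) : mulhom f -> f 1 = 1.
Proof. by move=> fM; apply: (@mulgI _ (f 1)); rewrite -fM !mulg1. Qed.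

Lemma mulhomV (P Q : groupType) (f : P -> Q) : mulhom f -> {morph f : a / a^-1}.
Proof. by move=> fM a; apply: (@mulgI _ (f a)); rewrite -fM !mulgV mulhom1. Qed.

Lemma mulhom_eval (P Q : groupType) (f : P -> Q) n (x : 'I_n -> P) w :
  mulhom f -> f (word_eval x w) = word_eval (f \o x) w.
Proof.
move=> fM; elim: w => [|[i b] w IH] /=; first exact: mulhom1.
by rewrite fM IH; case: b; rewrite /= ?mulhomV.
Qed.

Lemma word_eval_ext (G : groupType) n (x y : 'I_n -> G) w :
  x =1 y -> word_eval x w = word_eval y w.
Proof. by move=> xy; elim: w => [|l w IH] //=; rewrite IH xy. Qed.

Lemma word_eval_map (G : groupType) m n (h : 'I_m -> 'I_n) (x : 'I_n -> G) (w : word m) :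
  word_eval x [seq (h l.1, l.2) | l <- w] = word_eval (x \o h) w.
Proof. by elim: w => [|l w IH] //=; rewrite IH. Qed.

Definition pgen n (rels : seq (word n)) (i : 'I_n) : pgroup rels :=
  pclass rels [:: (i, true)].

Lemma pclass_cat n (rels : seq (word n)) u v :
  pclass rels (u ++ v) = pclass rels u * pclass rels v.
Proof. by apply/pclassP/pres_eq_cat; apply/pres_sym/pword_class. Qed.

Lemma pclass_inv n (rels : seq (word n)) w :
  pclass rels (winv w) = (pclass rels w)^-1.
Proof. by apply/pclassP/pres_eq_winv/pres_sym/pword_class. Qed.

Lemma word_eval_pgen n (rels : seq (word n)) w :
  word_eval (@pgen n rels) w = pclass rels w.
Proof.
elim: w => [|[i b] w IH] //=; rewrite IH -cat1s pclass_cat; congr (_ * _).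
by case: b => //; rewrite /pgen -pclass_inv.
Qed.

Lemma pgroup_fp n (rels : seq (word n)) : finitely_presented [set: pgroup rels].
Proof.
exists n, (@pgen n rels), rels; split=> [|w1 w2].
  apply/seteqP; split=> // a _; exists (pword a) => //.
  by rewrite word_eval_pgen pwordK.
by rewrite !word_eval_pgen; exact: pclassP.
Qed.

(** von Dyck's theorem. The group presented by [rels] is the range of
    [word_eval x], which may be a proper subset of [G], so [f] is
    described on words. *)
Lemma presented_lift (G Q : groupType) n (x : 'I_n -> G) (rels : seq (word n))
    (y : 'I_n -> Q) :
  (forall w1 w2, word_eval x w1 = word_eval x w2 -> pres_eq rels w1 w2) ->
  (forall r, r \in rels -> word_eval y r = 1) ->
  exists f : G -> Q, forall w, f (word_eval x w) = word_eval y w.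
Proof.
move=> xinj y1.
exists (fun g => word_eval y (xget [::] [set w | word_eval x w = g])) => w.
apply: (pres_eq_sound y1); apply: xinj.
by apply: (@xgetPex _ _ [set w' | word_eval x w' = word_eval x w]); exists w.
Qed.

Lemma pgroup_lift n (rels : seq (word n)) (Q : groupType) (y : 'I_n -> Q) :
  (forall r, r \in rels -> word_eval y r = 1) ->
  exists2 f : pgroup rels -> Q,
    mulhom f & forall w, f (pclass rels w) = word_eval y w.
Proof.
move=> y1; have [|f fE] := @presented_lift _ _ n (@pgen n rels) rels y _ y1.
  by move=> w1 w2; rewrite !word_eval_pgen => /pclassP.
have {}fE w : f (pclass rels w) = word_eval y w by rewrite -word_eval_pgen.
exists f => // a b; rewrite -(pwordK a) -(pwordK b) -pclass_cat !fE.
exact: word_eval_cat.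
Qed.

Section OverGroup.
Variables (G : groupType) (A : set G).

Definition is_subgroup (H : set G) :=
  [/\ H 1, forall g h, H g -> H h -> H (g * h) & forall g, H g -> H g^-1].

Lemma subgroup_eval H n (x : 'I_n -> G) w :
  is_subgroup H -> (forall i, H (x i)) -> H (word_eval x w).
Proof.
case=> H1 HM HV Hx; elim: w => [|[i b] w IH] //=.
by apply: HM => //; case: b => /=; auto.
Qed.

Hypothesis Asub : is_subgroup A.

(** Successive approximations to [A]; the homomorphism need not be onto. *)
Definition fp_over (P : groupType) (p : P -> G) :=
  [/\ finitely_presented [set: P], mulhom p & forall a, A (p a)].

Definition over_map (P Q : groupType) (p : P -> G) (q : Q -> G) (f : P -> Q) :=
  mulhom f /\ forall a, q (f a) = p a.

Lemma over_map_comp (P Q S : groupType) (p : P -> G) (q : Q -> G) (s : S -> G) f g :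
  over_map p q f -> over_map q s g -> over_map p s (g \o f).
Proof.
by move=> [fM fp] [gM gq]; split=> [a b|a] /=; rewrite ?fM ?gM // gq fp.
Qed.

Lemma fp_over_trivial : exists (P : groupType) (p : P -> G), fp_over p.
Proof.
have [//|f fM fE] := @pgroup_lift 0 [::] G (fun _ => 1).
exists (@pgroup 0 [::]), f; split=> //; first exact: pgroup_fp.
by move=> a; rewrite -(pwordK a) fE; apply: subgroup_eval => //; case: Asub.
Qed.

(** Juxtaposing two presentations presents the free product, which maps to [G]
    as soon as both factors do. *)
Lemma fp_over_adjoin (P : groupType) (p : P -> G) m (y : 'I_m -> G)
    (rels : seq (word m)) :
  fp_over p -> (forall i, A (y i)) -> (forall r, r \in rels -> word_eval y r = 1) ->
  exists (Q : groupType) (q : Q -> G) (f : P -> Q) (z : 'I_m -> Q),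
    [/\ fp_over q, over_map p q f, forall i, q (z i) = y i &
        forall r, r \in rels -> word_eval z r = 1].
Proof.
move=> [[n [x [prels [xsurj xP]]]] pM pA] Ay y1.
pose injl (w : word n) : word (n + m) := [seq (lshift m l.1, l.2) | l <- w].
pose injr (w : word m) : word (n + m) := [seq (rshift n l.1, l.2) | l <- w].
pose qrels := map injl prels ++ map injr rels.
pose g (i : 'I_(n + m)) : G := match fintype.split i with inl j => p (x j) | inr j => y j end.
have gl : g \o lshift m =1 p \o x.
  by move=> j; rewrite /g /= -[lshift m j]/(unsplit (inl j)) unsplitK.
have gr : g \o @rshift n m =1 y.
  by move=> j; rewrite /g /= -[rshift n j]/(unsplit (inr j)) unsplitK.
have [r|q qM qE] := @pgroup_lift _ qrels G g.
  rewrite mem_cat => /orP[] /mapP[w win ->]; rewrite word_eval_map.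
    rewrite (word_eval_ext _ gl) -mulhom_eval //.
    suff -> : word_eval x w = word_eval x [::] by exact: mulhom1.
    by apply/xP; have := pres_rel [::] [::] win; rewrite cats0.
  by rewrite (word_eval_ext _ gr) y1.
have [||f fE] := @presented_lift P (pgroup qrels) n x prels
    (fun j => pgen qrels (lshift m j)).
- by move=> w1 w2 /xP.
- move=> w win; rewrite -(word_eval_map _ (pgen qrels)) word_eval_pgen.
  apply/pclassP; rewrite -[X in pres_eq _ X _]cats0.
  by apply: (pres_rel [::] [::]); rewrite mem_cat map_f.
have fM : mulhom f.
  move=> a b.
  have [u _ <-] : range (word_eval x) a by rewrite xsurj.
  have [v _ <-] : range (word_eval x) b by rewrite xsurj.
  by rewrite -word_eval_cat !fE word_eval_cat.
exists (pgroup qrels), q, f, (fun j => pgen qrels (rshift n j)); split.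
- split=> //; first exact: pgroup_fp.
  move=> a; rewrite -(pwordK a) qE; apply: subgroup_eval => // i.
  by rewrite /g; case: fintype.split => j.
- split=> // a; have [u _ <-] : range (word_eval x) a by rewrite xsurj.
  rewrite fE !mulhom_eval //; apply: word_eval_ext => j.
  by rewrite /= /pgen qE /= mulg1; exact: gl.
- by move=> i; rewrite /pgen qE /= mulg1; exact: gr.
- move=> w win; rewrite -(word_eval_map _ (pgen qrels)) word_eval_pgen.
  apply/pclassP; rewrite -[X in pres_eq _ X _]cats0.
  by apply: (pres_rel [::] [::]); rewrite mem_cat map_f ?orbT.
Qed.

Lemma fp_over_elt (P : groupType) (p : P -> G) (T : eqType) (s : seq T) (a : T -> G) :
  fp_over p -> (forall t, t \in s -> A (a t)) ->
  exists (Q : groupType) (q : Q -> G) (f : P -> Q) (z : T -> Q),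
    [/\ fp_over q, over_map p q f & forall t, t \in s -> q (z t) = a t].
Proof.
move=> pP; elim: s => [|t s IH] As.
  by exists P, p, id, (fun=> 1); split.
have [u us|Q [q [f [z [qP fP zP]]]]] := IH; first by apply: As; rewrite inE us orbT.
have [|//|S [r [g [z' [rP gP z'P _]]]]] :=
  @fp_over_adjoin Q q 1 (fun=> a t) [::] qP.
  by move=> _; apply: As; rewrite inE eqxx.
exists S, r, (g \o f), (fun u => if u == t then z' ord0 else g (z u)); split=> //.
  exact: over_map_comp gP.
move=> u; rewrite inE; case: eqVneq => [-> _|_ /= us]; first exact: z'P.
by rewrite gP.2 zP.
Qed.

(** The free product with the subgroups [H t]. The inclusion of [H t] is a
    function [z t] on all of [G], of which only the values on [H t] matter. *)
Lemma fp_over_subgroup (P : groupType) (p : P -> G) (T : eqType) (s : seq T)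
    (H : T -> set G) :
  fp_over p -> (forall t, t \in s -> finitely_presented (H t)) ->
  (forall t, t \in s -> H t `<=` A) ->
  exists (Q : groupType) (q : Q -> G) (f : P -> Q) (z : T -> G -> Q),
    [/\ fp_over q, over_map p q f,
        forall t g h, t \in s -> H t g -> H t h -> z t (g * h) = z t g * z t h &
        forall t h, t \in s -> H t h -> q (z t h) = h].
Proof.
move=> pP; elim: s => [|t s IH] Hfp HA.
  by exists P, p, id, (fun _ _ => 1); split.
have [||Q [q [f [z [qP fP zM zP]]]]] := IH.
- by move=> u us; apply: Hfp; rewrite inE us orbT.
- by move=> u us; apply: HA; rewrite inE us orbT.
have [m [y [rels [yH yP]]]] := Hfp t (mem_head _ _).
have y1 r : r \in rels -> word_eval y r = 1.
  move=> rin; rewrite -[1]/(word_eval y [::]); apply/yP.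
  by have := pres_rel [::] [::] rin; rewrite cats0.
have [|S [r [g [x [rP gP xP x1]]]]] := @fp_over_adjoin Q q m y rels qP _ y1.
  move=> i; apply: (HA t (mem_head _ _)); rewrite -yH.
  by exists [:: (i, true)] => //=; rewrite mulg1.
have [|z' z'E] := @presented_lift G S m y rels x _ x1; first by move=> ? ? /yP.
exists S, r, (g \o f), (fun u => if u == t then z' else g \o z u); split=> //.
- exact: over_map_comp gP.
- move=> u h k; rewrite inE; case: eqVneq => [-> _|_ /= us]; last first.
    by move=> Hh Hk; rewrite zM // gP.1.
  by rewrite -yH => -[v _ <-] [w _ <-]; rewrite -word_eval_cat !z'E word_eval_cat.
- move=> u h; rewrite inE; case: eqVneq => [-> _|_ /= us].
    rewrite -yH => -[w _ <-]; rewrite z'E mulhom_eval; last by case: rP.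
    exact: word_eval_ext.
  by move=> Hh; rewrite gP.2 zP.
Qed.

(** Each element to be killed is spelled by a word, which becomes a relator. *)
Lemma fp_over_kill (P : groupType) (p : P -> G) (s : seq P) :
  fp_over p -> (forall k, k \in s -> p k = 1) ->
  exists (Q : groupType) (q : Q -> G) (f : P -> Q),
    [/\ fp_over q, over_map p q f & forall k, k \in s -> f k = 1].
Proof.
move=> [[n [x [rels [xsurj xP]]]] pM pA] ps.
pose wd k := xget [::] [set w | word_eval x w = k].
have wdK k : word_eval x (wd k) = k.
  have [w _ wk] : range (word_eval x) k by rewrite xsurj.
  by apply: (@xgetPex _ _ [set w | word_eval x w = k]); exists w.
have x1 r : r \in rels -> word_eval x r = 1.
  move=> rin; rewrite -[1]/(word_eval x [::]); apply/xP.
  by have := pres_rel [::] [::] rin; rewrite cats0.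
pose qrels := rels ++ map wd s.
have qrel1 r : r \in qrels -> pclass qrels r = 1.
  move=> rin; apply/pclassP; rewrite -[X in pres_eq _ X _]cats0.
  exact: (pres_rel [::] [::]).
have [r|q qM qE] := @pgroup_lift _ qrels G (p \o x).
  rewrite -mulhom_eval // mem_cat => /orP[/x1->|/mapP[k ks ->]].
    exact: mulhom1.
  by rewrite wdK ps.
have [||f fE] := @presented_lift P (pgroup qrels) n x rels (pgen qrels).
- by move=> w1 w2 /xP.
- by move=> w win; rewrite word_eval_pgen qrel1 // mem_cat win.
exists (pgroup qrels), q, f; split.
- split=> //; first exact: pgroup_fp.
  by move=> a; rewrite -(pwordK a) qE; apply: subgroup_eval => // i; exact: pA.
- split=> [a b|a]; rewrite -(wdK a); last by rewrite fE word_eval_pgen qE -mulhom_eval.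
  by rewrite -(wdK b) -word_eval_cat !fE word_eval_cat.
- move=> k ks; rewrite -(wdK k) fE word_eval_pgen qrel1 // mem_cat.
  by rewrite map_f ?orbT.
Qed.

(** Write [y i] for the images in [A] of the generators [x i] of [P]. Adding to
    the relators of [P] the relations saying that [x i] equals [rho (y i)]
    presents [A], since modulo these every word [w] equals [rho] of the element
    of [A] that it spells. *)
Lemma fp_retract (P : groupType) (p : P -> G) (rho : G -> P) :
  fp_over p -> (forall g h, A g -> A h -> rho (g * h) = rho g * rho h) ->
  (forall g, A g -> p (rho g) = g) -> finitely_presented A.
Proof.
move=> [[n [x [rels [xsurj xP]]]] pM pA] rM rK.
pose wd k := xget [::] [set w | word_eval x w = k].
have wdK k : word_eval x (wd k) = k.
  have [w _ wk] : range (word_eval x) k by rewrite xsurj.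
  by apply: (@xgetPex _ _ [set w | word_eval x w = k]); exists w.
pose y := p \o x.
have yE w : word_eval y w = p (word_eval x w) by rewrite mulhom_eval.
pose nrels := [seq winv [:: (i, true)] ++ wd (rho (y i)) | i <- enum 'I_n].
have [A1 AM AV] := Asub.
have r1 : rho 1 = 1 by apply: (@mulgI _ (rho 1)); rewrite -rM // !mulg1.
have rV g : A g -> rho g^-1 = (rho g)^-1.
  by move=> Ag; apply: (@mulgI _ (rho g)); rewrite -rM ?mulgV //; exact: AV.
have Ay w : A (word_eval y w) by rewrite yE.
have nE w : pres_eq (rels ++ nrels) w (wd (rho (word_eval y w))).
  have sub u v : word_eval x u = word_eval x v -> pres_eq (rels ++ nrels) u v.
    move/xP; elim=> {u v}.
    - exact: pres_refl.
    - by move=> *; exact: pres_sym.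
    - by move=> u v u' _ + _; exact: pres_trans.
    - exact: pres_cancel.
    - by move=> u v r rin; apply: pres_rel; rewrite mem_cat rin.
  have gen i : pres_eq (rels ++ nrels) [:: (i, true)] (wd (rho (y i))).
    apply: pres_sym; set v := wd _.
    apply: (@pres_trans _ _ _ ([:: (i, true)] ++ winv [:: (i, true)] ++ v)).
      exact/pres_sym/(pres_cancel _ [::] v).
    rewrite -[X in pres_eq _ _ X]cats0; apply: pres_eq_cat; first exact: pres_refl.
    have := @pres_rel n (rels ++ nrels) [::] [::] (winv [:: (i, true)] ++ v).
    rewrite cats0; apply; rewrite mem_cat; apply/orP; right.
    by apply/mapP; exists i => //; rewrite mem_enum.
  elim: w => [|[i b] w IH] /=; first by apply: sub; rewrite wdK r1.
  have Ayi : A (y i) by exact: pA.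
  apply: (@pres_trans _ _ _ (wd (rho (if b then y i else (y i)^-1)) ++
                             wd (rho (word_eval y w)))); last first.
    by apply: sub; rewrite word_eval_cat !wdK rM //; case: b => //; exact: AV.
  apply: (pres_eq_cat (u1 := [:: (i, b)])) => //; case: b; first exact: gen.
  apply: (@pres_trans _ _ _ (winv (wd (rho (y i))))).
    exact: (pres_eq_winv (gen i)).
  by apply: sub; rewrite word_eval_inv !wdK rV.
exists n, y, (rels ++ nrels); split.
  apply/seteqP; split=> [_ [w _ <-] //|g Ag].
  by exists (wd (rho g)) => //; rewrite yE wdK rK.
move=> w1 w2; split=> [e|].
  by apply: (pres_trans (nE w1)); rewrite e; exact/pres_sym/nE.
apply: pres_eq_sound => r; rewrite mem_cat => /orP[rin|/mapP[i _ ->]].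
  rewrite yE -(mulhom1 pM); congr p; apply/(xP r [::]).
  by have := pres_rel [::] [::] rin; rewrite cats0.
rewrite word_eval_cat word_eval_inv /= mulg1 yE wdK rK ?mulVg //.
exact: pA.
Qed.

End OverGroup.
End Over.

(** * Lifts along the components of a link *)

Section Combinatorial.
Local Open Scope group_scope.


Definition is_action (G : groupType) (T : Type) (act : G -> T -> T) :=
  (forall t, act 1 t = t) /\ (forall g h t, act (g * h) t = act g (act h t)).

Lemma action_VK (G : groupType) (T : Type) (act : G -> T -> T) g :
  is_action act -> cancel (act g) (act g^-1).
Proof. by move=> [a1 aM] t; rewrite -aM mulVg a1. Qed.

Lemma action_KV (G : groupType) (T : Type) (act : G -> T -> T) g :
  is_action act -> cancel (act g^-1) (act g).
Proof. by move=> [a1 aM] t; rewrite -aM mulgV a1. Qed.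

(** The representative is chosen from a set of candidates that is the same for
    all points of an orbit, hence it is constant on orbits. *)
Lemma orbit_reps (G : groupType) (A : set G) (T : choiceType) (act : G -> T -> T)
    (D : set T) (R : seq T) :
  is_subgroup A -> is_action act ->
  (forall t, D t -> exists g, A g /\ exists2 t0, t0 \in R & t = act g t0) ->
  exists (rep : T -> T) (tr : T -> G), forall t, D t ->
    [/\ rep t \in R, A (tr t), t = act (tr t) (rep t) &
        forall g, A g -> rep (act g t) = rep t].
Proof.
move=> [A1 AM AV] aP RP.
case: (pselect (exists t, D t)) => [[t1 _]|D0]; last first.
  by exists id, (fun=> 1) => t Dt; case: D0; exists t.
pose orb t := [set t0 | t0 \in R /\ exists2 g, A g & t = act g t0].
have orbN t : D t -> exists t0, orb t t0.
  by move=> /RP[g [Ag [t0 t0R e]]]; exists t0; split=> //; exists g.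
pose rep t := xget t1 (orb t).
pose tr t := xget 1 [set g | A g /\ t = act g (rep t)].
exists rep, tr => t Dt.
have [repR rept] : orb t (rep t) by apply: xgetPex; exact: orbN.
have [Atr trE] : [set g | A g /\ t = act g (rep t)] (tr t).
  by apply: xgetPex; case: rept => g; exists g.
split=> // g Ag; rewrite /rep; congr xget; apply/seteqP; split=> t0 [t0R [h Ah e]].
  split=> //; exists (g^-1 * h); first by apply/AM => //; exact: AV.
  by rewrite aP.2 -e action_VK.
by split=> //; exists (g * h); [exact: AM | rewrite aP.2 e].
Qed.

(** Finite generation as an induction principle. *)
Lemma fg_gens (G : groupType) (H : set G) : finitely_generated H ->
  exists s : seq G, (forall g, g \in s -> H g) /\
    forall S : set G, is_subgroup S -> (forall g, g \in s -> S g) -> H `<=` S.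
Proof.
move=> [n [x xH]]; exists [seq x i | i <- enum 'I_n]; split.
  by move=> _ /mapP[i _ ->]; rewrite -xH; exists [:: (i, true)]; rewrite //= mulg1.
move=> S Ssub xS h; rewrite -xH => -[w _ <-].
by apply: subgroup_eval => // i; apply: xS; rewrite map_f ?mem_enum.
Qed.

(** For the edges [E] and the triangles [F] of a complex, with repeated vertices
    allowed, this says that all components of the complex are simply connected:
    [k] is a homomorphism on edge paths up to homotopy, and it is trivial on loops
    when it is the coboundary of some [c]. *)
Definition cocycle_trivial (V : Type) (E : V -> V -> Prop) (F : V -> V -> V -> Prop) :=
  forall (P : groupType) (k : V -> V -> P),
    (forall a b c, F a b c -> k b c * k a b = k a c) ->
    exists c : V -> P, forall a b, E a b -> k a b = c b * (c a)^-1.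

Section LinkGroup.
Variables (G : groupType) (A : set G) (V : choiceType) (ac : G -> V -> V).
Variables (L1 : V -> Prop) (L2 : V -> V -> Prop) (L3 : V -> V -> V -> Prop).
Hypotheses (Asub : is_subgroup A) (acP : is_action ac).
Hypotheses (acL1 : forall g a, A g -> L1 a -> L1 (ac g a))
  (acL2 : forall g a b, A g -> L2 a b -> L2 (ac g a) (ac g b))
  (L2l : forall a b, L2 a b -> L1 a) (L2r : forall a b, L2 a b -> L1 b)
  (L3ab : forall a b c, L3 a b c -> L2 a b) (L3ac : forall a b c, L3 a b c -> L2 a c)
  (L3bc : forall a b c, L3 a b c -> L2 b c).
Variables (R1 : seq V) (R2 : seq (V * V)) (R3 : seq (V * V * V)).
Hypotheses
  (R1P : forall a, L1 a -> exists g, A g /\ exists2 t, t \in R1 & a = ac g t)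
  (R1L : forall t, t \in R1 -> L1 t)
  (R2P : forall a b, L2 a b -> exists g, A g /\
     exists2 t, t \in R2 & (a, b) = (ac g t.1, ac g t.2))
  (R2L : forall t, t \in R2 -> L2 t.1 t.2)
  (R3P : forall a b c, L3 a b c -> exists g, A g /\
     exists2 t, t \in R3 & (a, b, c) = (ac g t.1.1, ac g t.1.2, ac g t.2))
  (R3L : forall t, t \in R3 -> L3 t.1.1 t.1.2 t.2).
Hypothesis stab1 : forall a, L1 a -> finitely_presented [set g | A g /\ ac g a = a].
Hypothesis stab2 : forall a b, L2 a b ->
  finitely_generated [set g | [/\ A g, ac g a = a & ac g b = b]].
Hypothesis Ltriv : cocycle_trivial L2 L3.

(** Here [A] acts on a complex with vertices [L1], edges [L2] and triangles [L3],
    with repeated vertices allowed, such as the link of a vertex of which [A] is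
    the stabiliser. The lift [lam g a] of [g] does not project to [g] itself but to
    its conjugate by [r], because the component of [a] has first to be moved to
    that of a representative; the image of [p] need not contain the elements
    of [A] that do this. *)
Lemma fp_over_link : exists (P : groupType) (p : P -> G) (lam : G -> V -> P) (r : V -> G),
  [/\ fp_over A p,
      forall g h a, A g -> A h -> L1 a -> lam (g * h) a = lam g (ac h a) * lam h a,
      forall g a, A g -> L1 a -> p (lam g a) = (r (ac g a))^-1 * g * r a,
      forall a, L1 a -> A (r a) &
      forall a b, L2 a b -> r a = r b /\ forall g, A g -> lam g a = lam g b].
Proof.
have [A1 AM AV] := Asub.
have [rep [tr rtP]] := @orbit_reps G A V ac L1 R1 Asub acP R1P.
pose ac2 g (t : V * V) := (ac g t.1, ac g t.2).
have ac2P : is_action ac2.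
  by split=> [[a b]|g h [a b]]; rewrite /ac2 /= ?acP.1 ?acP.2.
have [rep2 [tr2 rt2P]] := @orbit_reps G A _ ac2 (fun t => L2 t.1 t.2) R2 Asub ac2P
  (fun t => match t with (a, b) => @R2P a b end).
have [P0 [p0 P0P]] := fp_over_trivial Asub.
have [t /R1L||P1 [p1 [_ [io [P1P _ ioM ioP]]]]] := fp_over_subgroup Asub
  (s := R1) (H := fun a => [set g | A g /\ ac g a = a]) P0P.
- exact: stab1.
- by move=> t _ g [].
(* Step 1: P1 contains the stabilisers of the representatives of vertices; the
   element st g a of such a stabiliser corresponds to moving a by g *)
pose st g a := (tr (ac g a))^-1 * g * tr a.
have stP g a : A g -> L1 a -> A (st g a) /\ ac (st g a) (rep a) = rep a.
  move=> Ag La; have [_ Ata ta repg] := rtP _ La.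
  have [_ Atga tga _] := rtP _ (acL1 Ag La); split.
    by apply/AM => //; apply/AM => //; exact: AV.
  by rewrite /st !acP.2 -ta {2}tga action_VK // repg.
pose lam1 g a := io (rep a) (st g a).
have lam1M g h a : A g -> A h -> L1 a -> lam1 (g * h) a = lam1 g (ac h a) * lam1 h a.
  move=> Ag Ah La; have [aR _ _ repg] := rtP _ La.
  have [s1 s2] := stP _ _ Ah La; have [s3 s4] := stP _ _ Ag (acL1 Ah La).
  rewrite /lam1 repg // -ioM //; last by rewrite -(repg _ Ah).
  congr io; rewrite /st acP.2 !mulgA mulgK //.
have lam1p g a : A g -> L1 a -> p1 (lam1 g a) = st g a.
  by move=> Ag La; have [aR _ _ _] := rtP _ La; apply: ioP => //; exact: stP.
have Atr a : L1 a -> A (tr a) by move=> /rtP[].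
(* Step 2: a generator z t for each representative t of the edges *)
have [t /R2L tL|P2 [p2 [f2 [z [P2P f2P zP]]]]] := fp_over_elt Asub
  (s := R2) (a := fun t => (tr t.2)^-1 * tr t.1) P1P.
  by apply/AM; [apply/AV|]; apply: Atr; [exact: L2r tL|exact: L2l tL].
pose lam2 g a := f2 (lam1 g a).
have lam2M g h a : A g -> A h -> L1 a -> lam2 (g * h) a = lam2 g (ac h a) * lam2 h a.
  by move=> Ag Ah La; rewrite /lam2 lam1M // f2P.1.
have lam2p g a : A g -> L1 a -> p2 (lam2 g a) = st g a.
  by move=> Ag La; rewrite f2P.2 lam1p.
have [gens gensP] : exists gens : V * V -> seq G, forall t, L2 t.1 t.2 ->
    (forall g, g \in gens t -> [/\ A g, ac g t.1 = t.1 & ac g t.2 = t.2]) /\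
    forall S : set G, is_subgroup S -> (forall g, g \in gens t -> S g) ->
      forall g, [/\ A g, ac g t.1 = t.1 & ac g t.2 = t.2] -> S g.
  suff /choice[gens gP] : forall t, exists s : seq G, L2 t.1 t.2 ->
    (forall g, g \in s -> [/\ A g, ac g t.1 = t.1 & ac g t.2 = t.2]) /\
    forall S : set G, is_subgroup S -> (forall g, g \in s -> S g) ->
      forall g, [/\ A g, ac g t.1 = t.1 & ac g t.2 = t.2] -> S g by exists gens.
  move=> t; case: (pselect (L2 t.1 t.2)) => [/stab2/fg_gens[s sP]|]; last by exists [::].
  by exists s.
(* Step 3: the relations making z t equivariant under the stabiliser of t *)
pose rel2 t h := (lam2 h t.2 * z t)^-1 * (z t * lam2 h t.1).
have [_ /allpairsPdep[t [h [tR hg ->]]]|P3 [p3 [f3 [P3P f3P f3K]]]] :=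
  fp_over_kill Asub (s := [seq rel2 t h | t <- R2, h <- gens t]) P2P.
  have tL := R2L tR; have [Ah h1 h2] := (gensP _ tL).1 _ hg.
  have [_ p2M _] := P2P; rewrite p2M (mulhomV p2M) !p2M !lam2p //;
    [|exact: L2l tL|exact: L2r tL].
  by rewrite zP // /st h1 h2; gsimp.
pose lam3 g a := f3 (lam2 g a).
have lam3M g h a : A g -> A h -> L1 a -> lam3 (g * h) a = lam3 g (ac h a) * lam3 h a.
  by move=> Ag Ah La; rewrite /lam3 lam2M // f3P.1.
have lam3p g a : A g -> L1 a -> p3 (lam3 g a) = st g a.
  by move=> Ag La; rewrite f3P.2 lam2p.
have lam31 a : L1 a -> lam3 1 a = 1.
  move=> La; apply: (@mulgI _ (lam3 1 a)); rewrite mulg1.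
  by rewrite -{1}(acP.1 a) -lam3M // mulg1.
have lam3V g a : A g -> L1 a -> lam3 g^-1 (ac g a) = (lam3 g a)^-1.
  move=> Ag La; apply: (@mulIg _ (lam3 g a)).
  by rewrite mulVg -lam3M ?mulVg ?lam31 //; exact/AV.
pose k0 t := f3 (z t).
(* the elements of the stabiliser for which the relation holds form a subgroup *)
have k0P t h : t \in R2 -> A h -> ac h t.1 = t.1 -> ac h t.2 = t.2 ->
    k0 t * lam3 h t.1 = lam3 h t.2 * k0 t.
  move=> tR Ah h1 h2; have tL := R2L tR; have [gP gS] := gensP _ tL.
  have [La Lb] := (L2l tL, L2r tL).
  pose S := [set h | [/\ A h, ac h t.1 = t.1, ac h t.2 = t.2 &
    k0 t * lam3 h t.1 = lam3 h t.2 * k0 t]].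
  suff : S h by case.
  apply: (gS S) => //; last first.
    move=> g gg; have [Ag g1 g2] := gP _ gg; split=> //.
    have := f3K (rel2 t g) (allpairs_f_dep _ tR gg).
    rewrite /rel2 f3P.1 (mulhomV f3P.1) !f3P.1 -/(k0 t) -/(lam3 g _) -/(lam3 g _).
    by move/mulg1_eq; rewrite invgK => ->.
  split; first by rewrite /S /= !acP.1 !lam31 // mulg1 mul1g.
    move=> g' g [Ag' g'1 g'2 g'k] [Ag g1 g2 gk]; rewrite /S /= !acP.2 g1 g2.
    split=> //; first exact: AM.
    by rewrite !lam3M // g1 g2 mulgA g'k -!mulgA gk.
  move=> g [Ag g1 g2 gk]; have Vg1 := action_VK g acP t.1.
  have Vg2 := action_VK g acP t.2; rewrite g1 in Vg1; rewrite g2 in Vg2.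
  split=> //; first exact: AV.
  have := lam3V _ _ Ag La; have := lam3V _ _ Ag Lb; rewrite g1 g2 => -> ->.
  by apply: (@mulIg _ (lam3 g t.1)); rewrite mulgVK -mulgA gk mulKg.
(* so k0 t can be transported to an edge ac g t by any g with the same effect *)
have k0_indep t g h : t \in R2 -> A g -> A h -> ac g t.1 = ac h t.1 ->
    ac g t.2 = ac h t.2 ->
    lam3 g t.2 * k0 t * (lam3 g t.1)^-1 = lam3 h t.2 * k0 t * (lam3 h t.1)^-1.
  move=> tR Ag Ah e1 e2; have [La Lb] := (L2l (R2L tR), L2r (R2L tR)).
  pose s := h^-1 * g; have As : A s by apply/AM => //; exact/AV.
  have s1 : ac s t.1 = t.1 by rewrite /s acP.2 e1 action_VK.
  have s2 : ac s t.2 = t.2 by rewrite /s acP.2 e2 action_VK.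
  have gE : g = h * s by rewrite mulVKg.
  clearbody s; rewrite gE !lam3M // s1 s2 invgM !mulgA -[_ * _ * k0 t]mulgA.
  rewrite -(k0P t s) //.
  by gsimp.
pose k3 a b := lam3 (tr2 (a, b)) (rep2 (a, b)).2 * k0 (rep2 (a, b)) *
  (lam3 (tr2 (a, b)) (rep2 (a, b)).1)^-1.
have k3g g a b : A g -> L2 a b ->
    k3 (ac g a) (ac g b) = lam3 g b * k3 a b * (lam3 g a)^-1.
  move=> Ag Lab; have [tR Ah tE repg] := rt2P (a, b) Lab.
  have [_ Ah' tE' _] := rt2P (ac g a, ac g b) (acL2 Ag Lab).
  have er := repg g Ag; rewrite /ac2 /= in er.
  rewrite er in tE'; rewrite /k3 er.
  case: tE => ea eb; case: tE' => ea' eb'.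
  have [La Lb] := (L2l (R2L tR), L2r (R2L tR)).
  rewrite (k0_indep _ _ (g * tr2 (a, b))) // ?acP.2 -?ea' -?eb' -?ea -?eb //.
    by rewrite !lam3M // -ea -eb; gsimp.
  exact: AM.
have k3p a b : L2 a b -> p3 (k3 a b) = (tr b)^-1 * tr a.
  move=> Lab; have [tR Ah [ea eb] _] := rt2P (a, b) Lab.
  have [La Lb] := (L2l (R2L tR), L2r (R2L tR)).
  have [_ p3M _] := P3P; rewrite /k3 !p3M (mulhomV p3M) !lam3p // f3P.2 zP //.
  by rewrite /st -ea -eb; gsimp.
(* Step 4: the relations making k3 a cocycle, one for each orbit of triangles;
   the others are translates of these by equivariance *)
clearbody k3; pose rel3 a b c := (k3 a c)^-1 * (k3 b c * k3 a b).
have [_ /mapP[[[a b] c] /R3L tL ->]|P4 [p4 [f4 [P4P f4P f4K]]]] :=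
  fp_over_kill Asub (s := [seq rel3 t.1.1 t.1.2 t.2 | t <- R3]) P3P.
  have [_ p3M _] := P3P.
  rewrite /rel3 !p3M (mulhomV p3M) !k3p; try by [exact: L3ab tL|exact: L3bc tL|exact: L3ac tL].
  by gsimp.
pose lam g a := f4 (lam3 g a); pose k a b := f4 (k3 a b).
have kg g a b : A g -> L2 a b -> k (ac g a) (ac g b) = lam g b * k a b * (lam g a)^-1.
  by move=> Ag Lab; rewrite /k k3g // !f4P.1 (mulhomV f4P.1).
have [c cP] : exists c : V -> P4, forall a b, L2 a b -> k a b = c b * (c a)^-1.
  apply: Ltriv => a b c Labc.
  have [g [Ag [t tR [-> -> ->]]]] := R3P Labc; have tL := R3L tR.
  rewrite !kg //; try by [exact: L3ab tL|exact: L3bc tL|exact: L3ac tL].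
  have := f4K (rel3 t.1.1 t.1.2 t.2) (map_f _ tR).
  rewrite /rel3 f4P.1 (mulhomV f4P.1) f4P.1 => /mulg1_eq; rewrite invgK => e.
  by rewrite /k e; gsimp.
(* equivariance of the coboundary k says that these lifts agree at the two ends
   of each edge *)
exists P4, p4, (fun g a => (c (ac g a))^-1 * lam g a * c a), (fun a => tr a * p4 (c a)).
have [_ p4M p4A] := P4P; split=> //.
- by move=> g h a Ag Ah La; rewrite /lam lam3M // f4P.1 acP.2; gsimp.
- move=> g a Ag La; rewrite !p4M (mulhomV p4M) f4P.2 lam3p // /st.
  by gsimp.
- by move=> a La; apply/AM => //; exact: Atr.
- move=> a b Lab; have [La Lb] := (L2l Lab, L2r Lab); split.
    have := k3p _ _ Lab; rewrite -f4P.2 -/(k a b) cP // p4M (mulhomV p4M) => e.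
    apply: (@mulIg _ (p4 (c a))^-1); rewrite mulgK -mulgA e; gsimp.
    by [].
  move=> g Ag; have := kg g a b Ag Lab; rewrite !cP //; last exact: acL2.
  move=> e; apply: (@mulgI _ (c (ac g b))); apply: (@mulIg _ (c a)^-1).
  rewrite mulgA mulgA mulgA mulgK e; gsimp.
  by [].
Qed.

End LinkGroup.

(** * Separation at a vertex *)

Section Paths.
Variable V : Type.
Implicit Types (E : V -> V -> Prop) (a b c w : V).

Inductive conn E a : V -> Prop :=
| conn0 : conn E a a
| connS b c : conn E a b -> E b c -> conn E a c.

Lemma conn1 E a b : E a b -> conn E a b.
Proof. by move=> ab; apply: connS ab; exact: conn0. Qed.

Lemma conn_trans E a b c : conn E a b -> conn E b c -> conn E a c.
Proof. by move=> ab; elim=> // d e _ ad; exact: connS. Qed.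

Lemma conn_sym E a b : (forall x y, E x y -> E y x) -> conn E a b -> conn E b a.
Proof.
move=> Es; elim=> [|c d _ ca /Es dc]; first exact: conn0.
exact: conn_trans (conn1 dc) ca.
Qed.

Lemma conn_map (E E' : V -> V -> Prop) (f : V -> V) a b :
  (forall x y, E x y -> E' (f x) (f y)) -> conn E a b -> conn E' (f a) (f b).
Proof.
move=> fE; elim=> [|c d _ ac /fE]; first exact: conn0.
exact: connS.
Qed.

End Paths.

Section Separation.
Variables (V : choiceType) (E : V -> V -> Prop) (F : V -> V -> V -> Prop) (v0 : V).
Hypotheses (Esym : forall a b, E a b -> E b a)
  (F12 : forall a b c, F a b c -> F b a c) (F23 : forall a b c, F a b c -> F a c b).

(** [off w] is the relation of lying in the same component of the complement
    of the vertex [w]. *)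
Definition off w := conn (fun a b => [/\ E a b, a != w & b != w]).
Definition link1 a := a != v0 /\ E v0 a.
Definition link2 a b := [/\ a != v0, b != v0 & F v0 a b].

Lemma off_sym w a b : off w a b -> off w b a.
Proof. by apply: conn_sym => x y [xy xw yw]; split=> //; exact: Esym. Qed.

Lemma off_trans w a b c : off w a b -> off w b c -> off w a c.
Proof. exact: conn_trans. Qed.

(** [d] is the vertex that follows the last visit to [v0] on a path to [a]. *)
Lemma off_link a : a != v0 -> conn E v0 a -> exists2 d, link1 d & off v0 d a.
Proof.
move=> av0 va; elim: va av0 => [|b c _ IH bc cv0]; first by rewrite eqxx.
have [bv|bv] := eqVneq b v0.
  by exists c; [split=> //; rewrite -bv | exact: conn0].
by have [d ld db] := IH bv; exists d => //; apply: connS db _.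
Qed.

(** A path meets only finitely many vertices, so it avoids all others. *)
Lemma off_cofinite a b : conn E a b ->
  exists q : seq V, forall w, w \notin q -> [/\ a != w, b != w & off w a b].
Proof.
elim=> [|c d _ [q qP] cd].
  by exists [:: a] => w; rewrite inE eq_sym => aw; split=> //; exact: conn0.
exists (d :: q) => w; rewrite inE negb_or eq_sym => /andP[dw /qP[aw cw ac]].
by split=> //; apply: connS ac _.
Qed.

(** Counting modulo 2 how often an edge path enters or leaves [v0] through the
    component of [a] in the link defines a cocycle. A path off [v0] from [a] to
    another component of the link would close up to a loop through [v0] that is
    counted once, but a coboundary vanishes on loops. *)
Lemma off_conn_link a b : cocycle_trivial E F ->
  link1 a -> link1 b -> off v0 a b -> conn link2 a b.
Proof.
move=> Etriv [av va] [bv vb] ab; apply: contrapT => nab.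
pose t : {perm 'I_2} := tperm ord0 (lift ord0 ord0).
have t2 : t * t = 1 by exact: tperm2.
have t1 : t <> 1 by move/permP/(_ ord0); rewrite tpermL perm1.
pose s x := if `[< conn link2 a x >] then t else 1.
pose k x y := if x == v0 then (if y == v0 then 1 else s y)
              else (if y == v0 then s x else 1).
have s2 x : s x * s x = 1 by rewrite /s; case: ifP => _; rewrite ?t2 ?mulg1.
have sE x y : link2 x y -> s x = s y.
  move=> xy; rewrite /s; suff -> : conn link2 a x = conn link2 a y by [].
  apply/propext; split=> h; first exact: connS xy.
  by apply: connS h _; case: xy => ? ? /F23.
have [|c cP] := Etriv _ k.
  move=> x y z xyz; rewrite /k.
  have [xv|xv] := eqVneq x v0; have [yv|yv] := eqVneq y v0;
    have [zv|zv] := eqVneq z v0; rewrite ?mulg1 ?mul1g ?s2 //; subst.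
  - by apply: sE; split.
  - by symmetry; rewrite -(sE x z) ?s2 //; split=> //; exact: F12.
  - by symmetry; apply: sE; split=> //; apply/F12/F23.
have cE x y : off v0 x y -> c x = c y.
  elim=> // y' z _ -> [yz yv zv]; have := cP _ _ yz.
  rewrite /k (negbTE yv) (negbTE zv) => /esym/divg1_eq //.
have := cP _ _ va; have := cP _ _ vb; rewrite /k eqxx (negbTE av) (negbTE bv).
rewrite (cE _ _ ab) => <-; rewrite /s asboolT; last exact: conn0.
by rewrite asboolF.
Qed.

End Separation.

End Combinatorial.

(** * The stabiliser of a vertex as a retract *)

Section VertexGroup.
Local Open Scope group_scope.
Variables (G : groupType) (V : choiceType) (ac : G -> V -> V).
Variables (E : V -> V -> Prop) (F : V -> V -> V -> Prop) (v0 : V).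
Hypotheses (acP : is_action ac) (acE : forall g a b, E a b -> E (ac g a) (ac g b))
  (Esym : forall a b, E a b -> E b a)
  (F12 : forall a b c, F a b c -> F b a c) (F23 : forall a b c, F a b c -> F a c b)
  (Econn : forall g, conn E v0 (ac g v0)) (Etriv : cocycle_trivial E F).
Local Notation A := [set g | ac g v0 = v0].
Local Notation L1 := (link1 E v0).
Local Notation L2 := (link2 F v0).

Definition in_orbit w := exists g, w = ac g v0.

Lemma in_orbit_ac g w : in_orbit w -> in_orbit (ac g w).
Proof. by move=> [h ->]; exists (g * h); rewrite acP.2. Qed.

Lemma ac_inj g : injective (ac g).
Proof. exact: can_inj (action_VK g acP). Qed.

Lemma off_ac g w a b : off E w a b -> off E (ac g w) (ac g a) (ac g b).
Proof.
apply: conn_map => x y [xy xw yw]; split; first exact: acE.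
  by rewrite (inj_eq (@ac_inj g)).
by rewrite (inj_eq (@ac_inj g)).
Qed.

Lemma stab_subgroup : is_subgroup A.
Proof.
split=> [|g h /= ga ha|g /= ga]; first exact: acP.1.
  by rewrite acP.2 ha ga.
by rewrite -{1}ga action_VK.
Qed.

Lemma cofinite_off g : exists q : seq V, forall w, w \notin q ->
  [/\ v0 != w, ac g v0 != w & off E w v0 (ac g v0)].
Proof. exact: off_cofinite (Econn g). Qed.

Variables (P : groupType) (p : P -> G) (lam : G -> V -> P) (r : V -> G).
Hypotheses (PP : fp_over A p)
  (lamM : forall g h a, A g -> A h -> L1 a -> lam (g * h) a = lam g (ac h a) * lam h a)
  (lamp : forall g a, A g -> L1 a -> p (lam g a) = (r (ac g a))^-1 * g * r a)
  (rA : forall a, L1 a -> A (r a))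
  (lamE : forall a b, L2 a b -> r a = r b /\ forall g, A g -> lam g a = lam g b).

(** [mu g w u] lifts [g], seen as a map from the star of [w] to that of its image,
    along the direction in which [u] is seen from [w]: the inverse of a coset
    representative [t w] carries this direction to a component of the link of
    [v0], to which [lam] applies. *)
Lemma vertex_cocycle : exists (mu : G -> V -> V -> P) (rho : V -> V -> G),
  forall w u, in_orbit w -> in_orbit u -> u != w ->
  [/\ forall g h, mu (h * g) w u = mu h (ac g w) (ac g u) * mu g w u,
      forall g, p (mu g w u) = (rho (ac g w) (ac g u))^-1 * g * rho w u,
      ac (rho w u) v0 = w &
      forall v, off E w u v -> rho w u = rho w v /\ forall g, mu g w u = mu g w v].
Proof.
have [A1 AM AV] := stab_subgroup.
have L1A g a : A g -> L1 a -> L1 (ac g a).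
  move=> Ag [av va]; rewrite /link1 -[in _ != _]Ag (inj_eq (@ac_inj g)); split=> //.
  by rewrite -[v0]Ag; exact: acE.
have lamC a b : conn L2 a b -> r a = r b /\ forall g, A g -> lam g a = lam g b.
  elim=> // c d _ [rc lc] /lamE[rd ld]; split; first by rewrite rc.
  by move=> g Ag; rewrite lc // ld.
(* a vertex of the link of v0 in the direction of u *)
pose dir u := xget v0 [set d | L1 d /\ off E v0 d u].
have dirP u : in_orbit u -> u != v0 -> L1 (dir u) /\ off E v0 (dir u) u.
  move=> [g ->] uv; have [d ld du] := off_link uv (Econn g).
  by apply: (@xgetPex _ v0 [set d | L1 d /\ off E v0 d (ac g v0)]); exists d.
have dirE u v : off E v0 u v -> dir u = dir v.
  move=> uv; rewrite /dir; congr xget; apply/seteqP; split=> d [ld du]; split=> //.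
    exact: off_trans du uv.
  exact: off_trans du (off_sym Esym uv).
have dirA g u : A g -> in_orbit u -> u != v0 ->
    r (dir (ac g u)) = r (ac g (dir u)) /\
    forall h, A h -> lam h (dir (ac g u)) = lam h (ac g (dir u)).
  move=> Ag uO uv; have [ld du] := dirP _ uO uv.
  have [|ld' du'] := dirP _ (in_orbit_ac g uO).
    by rewrite -[in _ != _]Ag (inj_eq (@ac_inj g)).
  apply: lamC; apply: (off_conn_link F12 F23 Etriv ld' (L1A _ _ Ag ld)).
  apply: off_trans du' _; apply: (off_sym Esym).
  by have := off_ac g du; rewrite Ag.
pose t w := xget 1 [set g | ac g v0 = w].
have tP w : in_orbit w -> ac (t w) v0 = w.
  by move=> [g ->]; apply: (@xgetPex _ _ [set h | ac h v0 = ac g v0]); exists g.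
have tVP w : in_orbit w -> ac (t w)^-1 w = v0.
  by move=> /tP {2}<-; rewrite action_VK.
pose st g w := (t (ac g w))^-1 * g * t w.
have stA g w : in_orbit w -> A (st g w).
  by move=> wO; rewrite /= /st !acP.2 tP // tVP //; exact: in_orbit_ac.
pose pull w u := ac (t w)^-1 u.
have pullP w u : in_orbit w -> in_orbit u -> u != w ->
    in_orbit (pull w u) /\ pull w u != v0.
  move=> wO uO uw; split; first exact: in_orbit_ac.
  by rewrite -(tVP w wO) (inj_eq (@ac_inj _)).
have pullg g w u : in_orbit w -> pull (ac g w) (ac g u) = ac (st g w) (pull w u).
  by move=> wO; rewrite /pull /st -!acP.2; gsimp.
have stM g h w : st (h * g) w = st h (ac g w) * st g w.
  by rewrite /st acP.2; gsimp.
exists (fun g w u => lam (st g w) (dir (pull w u))),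
  (fun w u => t w * r (dir (pull w u))) => w u wO uO uw.
have [pO pv] := pullP _ _ wO uO uw; have [ld du] := dirP _ pO pv.
split.
- move=> g h; rewrite pullg // stM lamM //; try exact: stA.
    by rewrite (dirA _ _ _ _ _).2 //; [exact: stA|apply: stA; exact: in_orbit_ac].
  by apply: stA; exact: in_orbit_ac.
- move=> g; rewrite lamp //; last exact: stA.
  rewrite pullg // (dirA _ _ _ _ _).1 //; last exact: stA.
  by rewrite {2}/st; gsimp.
- by rewrite acP.2 (rA ld) tP.
- move=> v uv; suff -> : dir (pull w u) = dir (pull w v) by [].
  by apply: dirE; have := off_ac (t w)^-1 uv; rewrite tVP.
Qed.

(** At each vertex [w] of the orbit of [v0] a generator of [G] acts through an
    element [mi i w] of an approximation to [A], and a word [W] through the product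
    [mw W w] of such elements along the orbit of [w]. The condition on the
    projection to [A] fixes the projection of [mw W w], which is what makes it
    possible to kill the values of relators; at [w = v0] and for [W] spelling an
    element of [A] the projection is this element. *)
Lemma stab_fp_of_link : finitely_presented [set: G] -> finitely_presented A.
Proof.
move=> [n [x [rels [xsurj xP]]]].
have [mu [rho muP]] := vertex_cocycle.
have [A1 AM AV] := stab_subgroup; have Asub := stab_subgroup.
have v0O : in_orbit v0 by exists 1; rewrite acP.1.
(* q g contains all vertices that separate v0 from its translate by g *)
have /choice[q qP] := cofinite_off.
pose R w := if w == v0 then 1 else rho w v0.
have RP w : in_orbit w -> ac (R w) v0 = w.
  move=> wO; rewrite /R; case: eqVneq => [->|wv]; first exact: acP.1.
  by have [|_ _ ->] := muP w v0 wO v0O; rewrite // eq_sym.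
have RA g w : in_orbit w -> A ((R (ac g w))^-1 * g * R w).
  move=> wO; rewrite /= !acP.2 RP // -{2}(RP (ac g w)) ?action_VK //.
  exact: in_orbit_ac.
have muR g w : in_orbit w -> ac g w \notin q g ->
    w != v0 /\ p (mu g w v0) = (R (ac g w))^-1 * g * R w.
  move=> wO /qP[gwv gwg gw].
  have wv : w != v0 by move: gwg; rewrite (inj_eq (@ac_inj g)) eq_sym.
  split=> //; have [|_ -> _ _] := muP w v0 wO v0O; first by rewrite eq_sym.
  have [|_ _ _ off_eq] := muP (ac g w) v0 (in_orbit_ac g wO) v0O; first by [].
  by rewrite -(off_eq _ gw).1 /R (negbTE wv) eq_sym (negbTE gwv).
have muV g w : in_orbit w -> w \notin q g ->
    (mu g (ac g^-1 w) v0)^-1 = mu g^-1 w v0.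
  move=> wO /qP[wv wg offw]; have gwO := in_orbit_ac g^-1 wO.
  have wgv : v0 != ac g^-1 w by rewrite -(inj_eq (@ac_inj g)) action_KV.
  have [M _ _ _] := muP _ _ gwO v0O wgv.
  have e : mu (1 * 1) (ac g^-1 w) v0 = 1 * mu 1 (ac g^-1 w) v0 by rewrite !mul1g.
  rewrite M !acP.1 in e; have {}e := mulIg _ _ _ e.
  have := M g g^-1; rewrite mulVg e action_KV // => /esym/mulg1_eq.
  have [_ _ _ off_eq] := muP _ _ wO v0O wv.
  by move=> <-; rewrite invgK (off_eq _ offw).2.
(* the finitely many places w whose image under x i separates v0 from its
   translate by x i; there mu (x i) w v0 has the wrong projection *)
pose bad := [seq (i, ac (x i)^-1 w) | i <- enum 'I_n,
                                      w <- [seq w <- q (x i) | `[< in_orbit w >]]].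
pose elt (t : 'I_n * V) := (R (ac (x t.1) t.2))^-1 * x t.1 * R t.2.
have [t|P1 [p1 [f [z [P1P fP zP]]]]] := fp_over_elt Asub (s := bad) (a := elt) PP.
  move=> /allpairsPdep[i [w [_ + ->]]]; rewrite mem_filter => /andP[/asboolP wO _].
  by apply: RA; exact: in_orbit_ac.
pose mi i w := if (i, w) \in bad then z (i, w) else f (mu (x i) w v0).
have miP i w : in_orbit w -> p1 (mi i w) = (R (ac (x i) w))^-1 * x i * R w.
  move=> wO; rewrite /mi; case: ifPn => [/zP //|nbad].
  rewrite fP.2 (muR _ _ _ _).2 //; apply: contra nbad => wq.
  apply/allpairsPdep; exists i, (ac (x i) w); rewrite mem_enum mem_filter wq.
  by rewrite action_VK //; split=> //; rewrite andbT; apply/asboolP/in_orbit_ac.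
pose ml (l : 'I_n * bool) w :=
  if l.2 then mi l.1 w else (mi l.1 (ac (x l.1)^-1 w))^-1.
pose xl (l : 'I_n * bool) := if l.2 then x l.1 else (x l.1)^-1.
have mlP l w : in_orbit w -> p1 (ml l w) = (R (ac (xl l) w))^-1 * xl l * R w.
  have [_ p1M _] := P1P; move=> wO; rewrite /ml /xl; case: l => i [] /=.
    exact: miP.
  by rewrite (mulhomV p1M) miP ?action_KV //; [gsimp|exact: in_orbit_ac].
pose mw := fix mw (W : word n) w :=
  if W is l :: W' then ml l (ac (word_eval x W') w) * mw W' w else 1.
have mw_cat W1 W2 w : mw (W1 ++ W2) w = mw W1 (ac (word_eval x W2) w) * mw W2 w.
  elim: W1 => [|l W1 IH] /=; first by rewrite mul1g.
  by rewrite IH word_eval_cat acP.2 mulgA.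
have mwP W w : in_orbit w ->
    p1 (mw W w) = (R (ac (word_eval x W) w))^-1 * word_eval x W * R w.
  have [_ p1M _] := P1P; move=> wO; elim: W => [|l W IH].
    by rewrite /= (mulhom1 p1M) acP.1; gsimp.
  rewrite /= p1M IH mlP -/(xl l) ?acP.2; last exact: in_orbit_ac.
  by gsimp.
have bad_q i w : w \notin q (x i) -> (i, ac (x i)^-1 w) \notin bad.
  apply: contra => /allpairsPdep[j [u [_ + [-> /ac_inj ->]]]].
  by rewrite mem_filter => /andP[].
have ml_mu l : exists s : seq V, forall w, in_orbit w -> w \notin s ->
    w != v0 /\ ml l w = f (mu (xl l) w v0).
  case: l => i [] /=.
    exists [seq ac (x i)^-1 w | w <- q (x i)] => w wO ws.
    have wq : ac (x i) w \notin q (x i).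
      by apply: contra ws => wq; apply/mapP; exists (ac (x i) w); rewrite ?action_VK.
    split; first by case: (muR _ _ wO wq).
    by rewrite /ml /mi /xl /= -(action_VK (x i) acP w) (negbTE (bad_q _ _ wq)).
  exists (q (x i)) => w wO wq; have [vw _ _] := qP _ _ wq; split; first by rewrite eq_sym.
  by rewrite /ml /mi /= (negbTE (bad_q _ _ wq)) -(mulhomV fP.1) muV.
(* by induction on W: the direction of v0 from the image of w may be replaced by
   that of the translate of v0, unless this image separates the two *)
have mw_mu W : exists s : seq V, forall w, in_orbit w -> w \notin s ->
    w != v0 /\ mw W w = f (mu (word_eval x W) w v0).
  elim: W => [|l W [s sP]].
    exists [:: v0] => w wO; rewrite inE => wv; split=> //=; rewrite eq_sym in wv.
    have [M _ _ _] := muP _ _ wO v0O wv; have := M 1 1; rewrite mulg1 !acP.1.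
    by rewrite -{1}[mu 1 w v0]mul1g => /mulIg <-; rewrite (mulhom1 fP.1).
  have [s' s'P] := ml_mu l; set g := word_eval x W in sP *.
  exists (v0 :: s ++ [seq ac g^-1 w | w <- s' ++ q g]) => w wO.
  rewrite inE mem_cat !negb_or => /and3P[wv ws wgs].
  have {wgs} : ac g w \notin s' ++ q g.
    by apply: contra wgs => h; apply/mapP; exists (ac g w); rewrite ?action_VK.
  rewrite mem_cat negb_or => /andP[ws' /qP[vgw _ offg]] /=.
  have gwO := in_orbit_ac g wO.
  rewrite (sP _ wO ws).2 (s'P _ gwO ws').2 -/(xl l) -fP.1; split=> //; congr f.
  have [_ _ _ off_eq] := muP _ _ gwO v0O vgw; rewrite (off_eq _ offg).2.
  by have [|M _ _ _] := muP _ _ wO v0O _; rewrite ?M // eq_sym.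
have /choice[s sP] := mw_mu.
(* the relators spell 1, which acts by 1 *)
pose ks := [seq mw rl w | rl <- rels, w <- [seq w <- s rl | `[< in_orbit w >]]].
have rel1 rl : rl \in rels -> word_eval x rl = 1.
  move=> rin; rewrite -[1]/(word_eval x [::]); apply/xP.
  by have := pres_rel [::] [::] rin; rewrite cats0.
have mu1 w : in_orbit w -> w != v0 -> mu 1 w v0 = 1.
  move=> wO; rewrite eq_sym => wv.
  have [M _ _ _] := muP _ _ wO v0O wv; have := M 1 1; rewrite mulg1 !acP.1.
  by rewrite -{1}[mu 1 w v0]mul1g => /mulIg.
have [_ /allpairsPdep[rl [w [rin + ->]]]|P2 [p2 [f2 [P2P f2P f2K]]]] :=
  fp_over_kill Asub (s := ks) P1P.
  rewrite mem_filter => /andP[/asboolP wO _].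
  by rewrite mwP // rel1 // acP.1; gsimp.
have f2mw u v : pres_eq rels u v -> forall w, in_orbit w -> f2 (mw u w) = f2 (mw v w).
  elim=> {u v} //.
  - by move=> u v _ IH w wO; rewrite IH.
  - by move=> u v t _ IH1 _ IH2 w wO; rewrite IH1 ?IH2.
  - move=> u v i b w wO; rewrite !mw_cat /=; case: b => /=.
      by rewrite /ml /= mulVKg acP.2 mulVKg.
    by rewrite /ml /= mulKg acP.2 action_VK // mulKg.
  - move=> u v rl rin w wO; rewrite !mw_cat word_eval_cat rel1 // mul1g.
    rewrite !f2P.1; set w' := ac _ w; have w'O : in_orbit w' by exact: in_orbit_ac.
    suff -> : f2 (mw rl w') = 1 by rewrite mul1g.
    case: (boolP (w' \in s rl)) => [ws|/(sP _ _ w'O)[w'v ->]].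
      apply: f2K; apply/allpairsPdep; exists rl, w'; rewrite mem_filter ws andbT.
      by split=> //; exact/asboolP.
    by rewrite rel1 // mu1 // (mulhom1 fP.1) (mulhom1 f2P.1).
have /choice[wd wdP] : forall g, exists W, word_eval x W = g.
  by move=> g; have [W _ <-] : range (word_eval x) g by [rewrite xsurj]; exists W.
apply: (fp_retract Asub (rho := fun g => f2 (mw (wd g) v0)) P2P) => [g h Ag Ah|g Ag].
  rewrite -f2P.1 -[in mw (wd g) _]Ah -[in ac h _](wdP h) -mw_cat.
  by apply: f2mw => //; apply/xP; rewrite word_eval_cat !wdP.
by rewrite f2P.2 mwP // wdP Ag /R eqxx; gsimp.
Qed.

End VertexGroup.

(** * The theorem for simplicial actions *)

Section CombinatorialTheorem.
Local Open Scope group_scope.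
Variables (G : groupType) (V : choiceType) (ac : G -> V -> V) (K : scomplex V).
Local Notation E := (fun a b => K [fset a; b]%fset).
Local Notation F := (fun a b c => K [fset a; b; c]%fset).
Hypotheses (acP : is_action ac) (acK : forall g s, K s -> K [fset ac g x | x in s]%fset).
Variables (v0 : V) (pts : seq V).
(* finitely many orbits of simplices of dimension at most 3 *)
Hypothesis ptsP : forall s, K s -> (#|` s|%fset <= 4)%N ->
  exists g, forall x, x \in s -> ac g x \in pts.
Hypotheses (Econn : forall g, conn E v0 (ac g v0)) (Etriv : cocycle_trivial E F).
Hypothesis Ltriv : cocycle_trivial (fun a b => link K v0 [fset a; b]%fset)
  (fun a b c => link K v0 [fset a; b; c]%fset).
Hypothesis stab1 : forall a b, a != b -> K [fset a; b]%fset ->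
  finitely_presented [set g | ac g a = a /\ ac g b = b].
Hypothesis stab2 : forall a b c, uniq [:: a; b; c] -> K [fset a; b; c]%fset ->
  finitely_generated [set g | [/\ ac g a = a, ac g b = b & ac g c = c]].
Local Notation A := [set g | ac g v0 = v0].

Lemma fp_fg (H : set G) : finitely_presented H -> finitely_generated H.
Proof. by move=> [n [x [rels [xH _]]]]; exists n, x. Qed.

Lemma vertex_stab_fp : finitely_presented [set: G] -> finitely_presented A.
Proof.
move=> hG.
have face (s t : {fset V}) x : (forall y, y \in t -> y \in s) -> x \in t -> K s -> K t.
  move=> ts xt Ks; apply: (simplex_face Ks); first exact/fsubsetP.
  by apply/fset0Pn; exists x.
pose L3 a b c := [/\ a != v0, b != v0, c != v0 & K [fset v0; a; b; c]%fset].
have acE g a b : E a b -> E (ac g a) (ac g b).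
  by move/(acK g); rewrite imfsetU !imfset_fset1.
have Asub := stab_subgroup v0 acP.
have acv g a : A g -> a != v0 -> ac g a != v0.
  by move=> Ag; rewrite -{2}Ag (inj_eq (ac_inj acP (g := g))).
pose h w := xget 1 [set g | ac g v0 = w].
have hP g : ac (h (ac g v0)) v0 = ac g v0.
  by apply: (@xgetPex _ _ [set k | ac k v0 = ac g v0]); exists g.
have hA g : A ((h (ac g v0))^-1 * g) by rewrite /= acP.2 -{2}(hP g) action_VK.
have acL2 g a b : A g -> link2 F v0 a b -> link2 F v0 (ac g a) (ac g b).
  move=> Ag [av bv vab]; split; try exact: acv.
  by have := acK g vab; rewrite !imfsetU !imfset_fset1 [ac g v0]Ag.
have acL3 g a b c : A g -> L3 a b c -> L3 (ac g a) (ac g b) (ac g c).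
  move=> Ag [av bv cv vabc]; split; try exact: acv.
  by have := acK g vabc; rewrite !imfsetU !imfset_fset1 [ac g v0]Ag.
have acL1 g a : A g -> link1 E v0 a -> link1 E v0 (ac g a).
  by move=> Ag [av va]; split; [exact: acv | rewrite -[v0]Ag; exact: acE].
(* finitely many simplices meet every A-orbit of simplices of the link *)
pose tl w a := ac (h w)^-1 a.
have tlP s : K s -> (#|` s|%fset <= 4)%N -> v0 \in s ->
    exists g w, [/\ A g, w \in pts & forall x, x \in s ->
      exists2 y, y \in pts & ac g x = tl w y].
  move=> Ks s4 v0s; have [g gP] := ptsP Ks s4.
  exists ((h (ac g v0))^-1 * g), (ac g v0); split=> //; first exact: gP.
  by move=> x /gP; exists (ac g x); rewrite // acP.2.
pose R1 := [seq a <- [seq tl w a | w <- pts, a <- pts] | `[< link1 E v0 a >]].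
pose R2 := [seq t <- [seq (a, b) | a <- R1, b <- R1] | `[< link2 F v0 t.1 t.2 >]].
pose R3 := [seq t <- [seq (ab, c) | ab <- R2, c <- R1] | `[< L3 t.1.1 t.1.2 t.2 >]].
have cardU1 (s : {fset V}) x n : (#|` s|%fset <= n)%N ->
    (#|` s `|` [fset x]|%fset <= n.+1)%N.
  move=> sn; rewrite fsetUC cardfsU1; case: (x \notin s) => //.
  exact: leq_trans sn _.
have link1lr a b : link2 F v0 a b -> link1 E v0 a /\ link1 E v0 b.
  move=> [av bv vab]; split; split=> //; apply: face (fset21 _ _) vab => y;
  by rewrite !inE => /orP[] ->; rewrite ?orbT.
have link2lr a b c : L3 a b c ->
    [/\ link2 F v0 a b, link2 F v0 b c & link2 F v0 a c].
  move=> [av bv cv vabc]; split; split=> //; apply: (@face _ _ v0 _ _ vabc) => [y|];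
  by rewrite !inE ?eqxx // => /orP[/orP[]|] ->; rewrite ?orbT.
have tlR1 g w a y : A g -> link1 E v0 a -> w \in pts -> y \in pts ->
    ac g a = tl w y -> ac g a \in R1.
  move=> Ag La wp yp e; rewrite mem_filter; apply/andP; split.
    by apply/asboolP; exact: acL1.
  by apply/allpairsP; exists (w, y).
have L1R1 a : link1 E v0 a -> exists g, A g /\ exists2 t, t \in R1 & a = ac g t.
  move=> La; have [|||g [w [Ag wp gP]]] := @tlP [fset v0; a]%fset.
  - by case: La.
  - by do 1!apply/cardU1; rewrite cardfs1.
  - by rewrite !inE eqxx.
  have [|y yp e] := gP a; first by rewrite !inE eqxx orbT.
  exists g^-1; split; first by case: Asub => _ _; apply.
  by exists (ac g a); rewrite ?action_VK //; exact: tlR1 e.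
have L2R2 a b : link2 F v0 a b -> exists g, A g /\
    exists2 t, t \in R2 & (a, b) = (ac g t.1, ac g t.2).
  move=> Lab; have [La Lb] := link1lr _ _ Lab.
  have [|||g [w [Ag wp gP]]] := @tlP [fset v0; a; b]%fset.
  - by case: Lab.
  - by do 2!apply/cardU1; rewrite cardfs1.
  - by rewrite !inE eqxx.
  have [|y yp e] := gP a; first by rewrite !inE eqxx !orbT.
  have [|z zp e'] := gP b; first by rewrite !inE eqxx !orbT.
  exists g^-1; split; first by case: Asub => _ _; apply.
  exists (ac g a, ac g b); rewrite /= ?action_VK // mem_filter.
  apply/andP; split; first by apply/asboolP; exact: acL2.
  by apply/allpairsP; exists (ac g a, ac g b); split=> //=; [exact: tlR1 e|exact: tlR1 e'].
have L3R3 a b c : L3 a b c -> exists g, A g /\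
    exists2 t, t \in R3 & (a, b, c) = (ac g t.1.1, ac g t.1.2, ac g t.2).
  move=> Labc; have [Lab Lbc _] := link2lr _ _ _ Labc.
  have [La Lb] := link1lr _ _ Lab; have [_ Lc] := link1lr _ _ Lbc.
  have [|||g [w [Ag wp gP]]] := @tlP [fset v0; a; b; c]%fset.
  - by case: Labc.
  - by do 3!apply/cardU1; rewrite cardfs1.
  - by rewrite !inE eqxx.
  have [|y yp e] := gP a; first by rewrite !inE eqxx !orbT.
  have [|z zp e'] := gP b; first by rewrite !inE eqxx !orbT.
  have [|u up e''] := gP c; first by rewrite !inE eqxx !orbT.
  exists g^-1; split; first by case: Asub => _ _; apply.
  exists (ac g a, ac g b, ac g c); rewrite /= ?action_VK // mem_filter.
  apply/andP; split; first by apply/asboolP; exact: acL3.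
  apply/allpairsP; exists ((ac g a, ac g b), ac g c); split=> //=; last exact: tlR1 e''.
  rewrite mem_filter; apply/andP; split; first by apply/asboolP; exact: acL2.
  by apply/allpairsP; exists (ac g a, ac g b); split=> //=; [exact: tlR1 e|exact: tlR1 e'].
have inR1 t : t \in R1 -> link1 E v0 t by rewrite mem_filter => /andP[/asboolP].
have inR2 t : t \in R2 -> link2 F v0 t.1 t.2 by rewrite mem_filter => /andP[/asboolP].
have inR3 t : t \in R3 -> L3 t.1.1 t.1.2 t.2 by rewrite mem_filter => /andP[/asboolP].
have Lstab1 a : link1 E v0 a -> finitely_presented [set g | A g /\ ac g a = a].
  by move=> [av va]; apply: stab1; rewrite // eq_sym.
have Lstab2 a b : link2 F v0 a b ->
    finitely_generated [set g | [/\ A g, ac g a = a & ac g b = b]].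
  move=> Lab; have [La _] := link1lr _ _ Lab; case: Lab => av bv vab.
  have [e|ab] := eqVneq a b; last first.
    by apply: stab2 => //=; rewrite !inE negb_or ab eq_sym av eq_sym bv.
  rewrite -e; have := fp_fg (Lstab1 _ La); congr finitely_generated.
  by apply/seteqP; split=> g /=; [case|case].
have Ltriv' : cocycle_trivial (link2 F v0) L3.
  have v0n (s : {fset V}) : (forall x, x \in s -> x != v0) -> v0 \notin s.
    by move=> sv; apply/negP => /sv; rewrite eqxx.
  move=> Q k kP; have [a b c [Kabc vabc Kvabc]|c cP] := @Ltriv Q k.
    have nv x : x \in [fset a; b; c]%fset -> x != v0 by apply: contraTneq => ->.
    apply: kP; split; try by apply: nv; rewrite !inE eqxx ?orbT.
    by rewrite !fsetUA in Kvabc.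
  exists c => a b [av bv vab]; apply: cP; split.
  - by apply: face (fset21 _ _) vab => y; rewrite !inE => /orP[] ->; rewrite ?orbT.
  - by apply: v0n => x; rewrite !inE => /orP[] /eqP ->.
  - by rewrite fsetUA.
have [P [p [lam [r [PP lamM lamp rA lamE]]]]] := fp_over_link Asub acP acL1 acL2
  (fun a b l => (link1lr a b l).1) (fun a b l => (link1lr a b l).2)
  (fun a b c l => let: And3 x y z := link2lr a b c l in x)
  (fun a b c l => let: And3 x y z := link2lr a b c l in z)
  (fun a b c l => let: And3 x y z := link2lr a b c l in y)
  L1R1 inR1 L2R2 inR2 L3R3 inR3 Lstab1 Lstab2 Ltriv'.
have Esym a b : E a b -> E b a by rewrite fsetUC.
have F12 a b c : F a b c -> F b a c by rewrite [([fset a; b])%fset]fsetUC.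
have F23 a b c : F a b c -> F a c b by rewrite -!fsetUA [([fset b; c])%fset]fsetUC.
exact: (stab_fp_of_link acP acE Esym F12 F23 Econn Etriv PP lamM lamp rA lamE hG).
Qed.

End CombinatorialTheorem.

(** * The weak topology *)

Section Topology.
Import Order.TTheory GRing.Theory Num.Theory.
Import numFieldNormedType.Exports.
Local Open Scope ring_scope.
Variables (R : realType) (V : choiceType).
Implicit Types (K : scomplex V).

Lemma open_weakE K (U : set (realization R K)) : open U <-> weak_open U.
Proof. by []. Qed.

Lemma realization_eq K (x y : realization R K) : (forall v, x v = y v) -> x = y.
Proof.
case: x y => [x x0 xs] [y y0 ys] /= xy; have {}xy : x = y by apply/funext.
by rewrite xy in x0 xs *; congr RPoint; exact: Prop_irrelevance.
Qed.

(** The support of [c] is a face of [s]. *)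
Lemma mk_point K (s : {fset V}) (c : V -> R) : K s -> (forall v, 0 <= c v) ->
  (forall v, 0 < c v -> v \in s) -> \sum_(v <- s) c v = 1 ->
  exists x : realization R K, forall v, x v = c v.
Proof.
move=> Ks c0 cs c1.
suff h : exists s, [/\ K s, forall v, (v \in s) = (0 < c v) & \sum_(v <- s) c v = 1].
  by exists (RPoint c0 h).
pose t := [fset v in s | 0 < c v]%fset.
have tE v : (v \in t) = (0 < c v).
  by rewrite !inE andb_idl //; exact: cs.
have t1 : \sum_(v <- t) c v = 1.
  rewrite -c1; symmetry; rewrite (big_fsetID _ (fun v => 0 < c v)) /=.
  rewrite [X in _ + X]big1_fset ?addr0 // => v; rewrite !inE => /andP[_ vn] _.
  by apply/eqP; rewrite eq_le c0 andbT leNgt.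
exists t; split=> //; apply: (simplex_face Ks).
  by apply/fsubsetP => v; rewrite !inE => /andP[].
apply/eqP => t0; move: t1; rewrite t0 big_seq_fset0 => /eqP.
by rewrite eq_sym oner_eq0.
Qed.

Lemma closed_cell_out K s (x : realization R K) v :
  closed_cell s x -> v \notin s -> x v = 0.
Proof.
move=> xs vs; apply/eqP; rewrite eq_le coord_ge0 andbT leNgt.
by apply: contra vs => /xs.
Qed.

Lemma coord_continuous K v : continuous (fun x : realization R K => x v : R).
Proof.
apply/continuousP => U oU; apply/open_weakE => s Ks x xs Ux.
have [e /= e0 eU] : nbhs_ball (x v) U by apply/nbhs_ballP; exact: open_nbhs_nbhs.
exists e => // y ys xy; apply: eU.
have [vs|vs] := boolP (v \in s); first exact: xy.
by rewrite /ball /= !(closed_cell_out _ vs) // subrr normr0.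
Qed.

Lemma star_open K v : open [set x : realization R K | 0 < x v].
Proof.
by have /continuousP/(_ _ (@open_gt R 0)) := @coord_continuous K v.
Qed.

(** On a finite union of closed cells the weak topology is that of the
    coordinates, because each closed cell is defined by closed conditions. *)
Lemma realization_continuous K (T : topologicalType) (f : T -> realization R K)
    (ss : seq {fset V}) :
  (forall v, continuous (fun t => f t v : R)) ->
  (forall s, s \in ss -> K s) -> (forall t, exists2 s, s \in ss & closed_cell s (f t)) ->
  continuous f.
Proof.
move=> cf Kss fss; apply/continuousP => U /open_weakE oU.
rewrite openE => t /= Ut.
have near_s s : K s -> \forall t' \near t, closed_cell s (f t') -> U (f t').
  move=> Ks; have [ts|nts] := pselect (closed_cell s (f t)).
    have [e e0 eU] := oU s Ks _ ts Ut.
    have near_v v : \forall t' \near t, `|f t v - f t' v| < e.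
      by have /cvgrPdist_lt := cf v t; apply.
    have near_seq (q : seq V) :
        \forall t' \near t, forall v, v \in q -> `|f t v - f t' v| < e.
      elim: q => [|v q IH]; first by apply: nearW => t' ?; rewrite in_nil.
      near=> t' => u; rewrite inE => /orP[/eqP ->|]; first by near: t'; exact: near_v.
      by move: u; near: t'.
    near=> t' => t's; apply: (eU _ t's) => v vs.
    move: v vs; near: t'; exact: near_seq.
  have [v [fv vs]] : exists v, 0 < f t v /\ v \notin s.
    apply: contrapT => h; apply: nts => v fv.
    by apply: contrapT => /negP vs; apply: h; exists v.
  have : \forall t' \near t, 0 < f t' v by apply: (cvgr_gt _ (cf v t)).
  apply: filterS => t' ft' /(_ _ ft'); by rewrite (negbTE vs).
have near_all (q : seq {fset V}) : {subset q <= ss} ->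
    \forall t' \near t, forall s, s \in q -> closed_cell s (f t') -> U (f t').
  elim: q => [_|s q IH sq]; first by apply: nearW => t' ?; rewrite in_nil.
  have IH' := IH (fun u uq => sq u (mem_behead (s := s :: q) uq)).
  have hs := near_s s (Kss _ (sq _ (mem_head _ _))).
  near=> t' => u; rewrite inE => /orP[/eqP ->|]; first by near: t'.
  by move: u; near: t'.
have := near_all ss (fun _ h => h); apply: filterS => t' ht'.
by have [s sss t's] := fss t'; exact: ht' t's.
Unshelve. all: by end_near. Qed.

Lemma realization_star K (x : realization R K) : exists v, 0 < x v.
Proof.
have [s [Ks sx _]] := coord_supp x; have /fset0Pn[v vs] := simplex_neq0 Ks.
by exists v; rewrite -sx.
Qed.

(** Lebesgue number for the cover of the realization by open stars. *)
Lemma lebesgue_star K (T : pseudoMetricType R) (A : set T)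
    (f : T -> realization R K) :
  compact A -> {within A, continuous f} ->
  exists2 e : R, 0 < e &
    forall x, A x -> exists v, forall y, A y -> ball x e y -> 0 < f y v.
Proof.
move=> /compact_near_coveringP cA cf.
have [] := cA nat \oo
  (fun n x => exists v, forall y, A y -> ball x (n.+1%:R^-1 : R) y -> 0 < f y v) _ _.
  move=> x Ax; have [v xv] := realization_star (f x).
  have /nbhs_ballP[e /= e0 eP] : within A (nbhs x) [set y | 0 < f y v].
    have /subspace_continuousP/(_ x Ax) h := cf.
    apply: (h [set z : realization R K | 0 < z v]).
    exact: open_nbhs_nbhs (conj (@star_open K v) xv).
  have e20 : 0 < e / 2 by rewrite divr_gt0.
  have := near_infty_natSinv_lt (PosNum e20).
  have := nbhsx_ballx x (e / 2) e20.
  move=> H1 H2; exists ([set y | ball x (e / 2) y],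
    [set n | n.+1%:R^-1 < e / 2]) => //= -[x' n] /= [xx' ne].
  exists v => y Ay x'y; apply: eP => //.
  by rewrite [e]splitr; apply: ball_triangle xx' (le_ball (ltW ne) x'y).
move=> n _ /(_ n (leqnn n)) nP; exists (n.+1%:R^-1) => //.
Qed.

Lemma star_simplex K (x : realization R K) (s : {fset V}) v :
  v \in s -> (forall v, v \in s -> 0 < x v) -> K s.
Proof.
move=> vs sx; have [t [Kt tx _]] := coord_supp x.
apply: (simplex_face Kt); last by apply/fset0Pn; exists v.
by apply/fsubsetP => u us; rewrite tx sx.
Qed.

(** At time [s] the vertex [u k] of an edge path has the weight
    [clamp (s - k + 1) - clamp (s - k)], a tent function around [k]; in this form
    the sum of the weights telescopes. *)
Let clamp (y : R) := Num.max 0 (Num.min 1 y).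

Let clamp0 y : y <= 0 -> clamp y = 0.
Proof. by move=> y0; rewrite /clamp max_l // ge_min y0 orbT. Qed.

Let clamp1 y : 1 <= y -> clamp y = 1.
Proof. by move=> y1; rewrite /clamp min_l // max_r. Qed.

Let le_clamp y z : y <= z -> clamp y <= clamp z.
Proof.
move=> yz; rewrite /clamp ge_max le_max lexx /= le_max; apply/orP; right.
by rewrite le_min !ge_min lexx yz orbT.
Qed.

Let clamp_continuous : continuous clamp.
Proof.
move=> t; apply: (@continuous_max R R (fun=> 0) (fun t => Num.min 1 t)).
  exact: cst_continuous.
by apply: (@continuous_min R R (fun=> 1) id); [exact: cst_continuous|exact: cvg_id].
Qed.

Let sum_eq (a : V) (s : {fset V}) :
  \sum_(v <- s) (a == v)%:R = (a \in s)%:R :> R.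
Proof.
rewrite -natr_sum; congr _%:R; rewrite -(count_uniq_mem a (fset_uniq s)) -sum1_count.
by rewrite [RHS]big_mkcond; apply: eq_bigr => v _; rewrite /= eq_sym; case: eqP.
Qed.

(** The path is piecewise linear. Times outside of the interval from 0 to [n] are
    projected to it, which makes the path continuous on all of [R]. *)
Lemma edge_path K (u : nat -> V) n : (0 < n)%N ->
  (forall k, (k < n)%N -> K [fset u k; u k.+1]%fset) ->
  exists g : R -> realization R K, [/\ continuous g,
    forall k v, (k <= n)%N -> 0 < g k%:R v -> v = u k &
    forall k s v, (k < n)%N -> k%:R <= s <= k.+1%:R -> 0 < g s v ->
      v = u k \/ v = u k.+1].
Proof.
move=> n0 Ku.
pose cl (s : R) := Num.max 0 (Num.min n%:R s).
have clP s : 0 <= cl s <= n%:R.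
  by rewrite /cl le_max lexx /= ge_max ler0n ge_min lexx.
have cl_id s : 0 <= s <= n%:R -> cl s = s.
  by move=> /andP[s0 sn]; rewrite /cl min_r // max_r.
pose w (s : R) (k : nat) := clamp (s - k%:R + 1) - clamp (s - k%:R).
have w_ge0 s k : 0 <= w s k by rewrite subr_ge0 le_clamp // lerDl.
have w_gt0 s k : 0 < w s k -> k%:R - 1 < s < k%:R + 1.
  move=> wk; apply/andP; split; rewrite ltNge; apply/negP => h; move: wk; rewrite /w.
    by rewrite !clamp0 ?subrr ?ltxx //; lra.
  by rewrite !clamp1 ?subrr ?ltxx //; lra.
have w_sum s : 0 <= s <= n%:R -> \sum_(k < n.+1) w s k = 1.
  move=> sn; pose D (k : nat) := - clamp (s - k%:R + 1).
  transitivity (\sum_(0 <= k < n.+1) (D k.+1 - D k)).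
    rewrite big_mkord; apply: eq_bigr => k _; rewrite /w /D opprK [RHS]addrC.
    by have -> : s - k.+1%:R + 1 = s - k%:R by rewrite -natr1; ring.
  rewrite telescope_sumr // /D clamp0 ?clamp1; by rewrite -?natr1; lra.
pose c s v := \sum_(k < n.+1) w (cl s) k * (u k == v)%:R.
have c_gt0 s v : 0 < c s v -> exists2 k, (k <= n)%N & 0 < w (cl s) k /\ v = u k.
  move=> cv; apply: contrapT => h; move: cv; rewrite /c big1 ?ltxx // => k _.
  have [e|] := eqVneq (u k) v; last by rewrite mulr0.
  rewrite mulr1; apply/eqP; rewrite eq_le w_ge0 andbT leNgt; apply/negP => wk.
  by apply: h; exists (k : nat); first by rewrite -ltnS ltn_ord.
have seg m (s : R) : (0 < m)%N -> 0 <= s <= m%:R ->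
    exists2 k, (k < m)%N & k%:R <= s <= k.+1%:R.
  elim: m => // m IH _ /andP[s0 sm].
  have [ms|ms] := leP m%:R s; first by exists m; rewrite ?ms.
  have m0 : (0 < m)%N.
    by rewrite lt0n; apply/eqP => m0; move: ms; rewrite m0; lra.
  have [|k km ks] := IH m0; first by rewrite s0 ltW.
  by exists k => //; exact: ltnW.
have c_seg s k v : k%:R <= cl s <= k.+1%:R -> 0 < c s v -> v = u k \/ v = u k.+1.
  move=> /andP[ks sk] /c_gt0[j _ [/w_gt0 /andP[js sj] ->]].
  have j1 : (j < k.+2)%N by rewrite -(ltr_nat R); move: js sk; rewrite -!natr1; lra.
  have j2 : (k < j.+1)%N by rewrite -(ltr_nat R); move: sj ks; rewrite -!natr1; lra.
  have [->|] := eqVneq j k; first by left.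
  move=> jk; right; congr u; move: j2; rewrite ltnS leq_eqVlt eq_sym (negbTE jk) /=.
  by move=> j2; apply/eqP; rewrite eqn_leq -ltnS j1 j2.
have /choice[g gE] : forall s, exists x : realization R K, forall v, x v = c s v.
  move=> s; have [k kn ks] := seg _ _ n0 (clP s).
  have cs v : 0 < c s v -> v \in [fset u k; u k.+1]%fset.
    by move=> /(c_seg _ _ _ ks)[] ->; rewrite !inE eqxx ?orbT.
  apply: (mk_point (Ku _ kn) _ cs) => [v|].
    by apply: sumr_ge0 => j _; rewrite mulr_ge0.
  rewrite exchange_big /= -[RHS](w_sum _ (clP s)); apply: eq_bigr => j _.
  rewrite -mulr_sumr sum_eq.
  have [w0|w0] := eqVneq (w (cl s) j) 0; first by rewrite w0 mul0r.
  suff -> : u j \in [fset u k; u k.+1]%fset by rewrite mulr1.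
  apply: cs; rewrite /c (bigD1 j) //= eqxx mulr1 ltr_pwDl //.
    by rewrite lt_def w0 w_ge0.
  by apply: sumr_ge0 => i _; rewrite mulr_ge0.
exists g; split.
- apply: (@realization_continuous K _ g [seq [fset u k; u k.+1]%fset | k <- iota 0 n]).
  + move=> v; have -> : (fun t => g t v) = c^~ v.
      apply/funext => t.
      by rewrite gE.
    have cl_cont : continuous cl.
      move=> t; apply: (@continuous_max R R (fun=> 0) (fun t => Num.min n%:R t)).
        exact: cst_continuous.
      by apply: (@continuous_min R R (fun=> n%:R) id); [exact: cst_continuous|exact: cvg_id].
    apply: continuous_big => [|k _ t]; first exact: add_continuous.
    have comp h : continuous h -> continuous (fun t : R => clamp (h t) : R).
      by move=> ch y; apply: continuous_comp; [exact: ch | exact: clamp_continuous].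
    have shift (a : R) : continuous (fun t : R => cl t + a : R).
      by move=> y; apply: cvgD; [exact: cl_cont|exact: cvg_cst].
    apply: cvgMl; apply: cvgB; last exact: (comp _ (shift _)).
    by apply: (comp (fun t => cl t - k%:R + 1)) => y; apply: cvgD; [exact: shift|exact: cvg_cst].
  + by move=> _ /mapP[k + ->]; rewrite mem_iota => /andP[_ kn]; exact: Ku.
  + move=> t; have [k kn ks] := seg _ _ n0 (clP t).
    exists [fset u k; u k.+1]%fset; first by apply/mapP; exists k; rewrite ?mem_iota.
    by move=> v; rewrite gE => /(c_seg _ _ _ ks)[] ->; rewrite !inE eqxx ?orbT.
- move=> k v kn; rewrite gE => /c_gt0[j _ [+ ->]].
  rewrite cl_id ?ler0n ?ler_nat // => /w_gt0/andP[jk kj]; congr u.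
  have j1 : (j < k.+1)%N by rewrite -(ltr_nat R) -natr1; lra.
  have j2 : (k < j.+1)%N by rewrite -(ltr_nat R) -natr1; lra.
  by apply/eqP; rewrite eqn_leq -ltnS j1 -ltnS j2.
- move=> k s v kn ks; rewrite gE; apply: c_seg; rewrite cl_id //.
  case/andP: ks => ks sk; rewrite (le_trans (ler0n _ _) ks) (le_trans sk) //.
  by rewrite ler_nat.
Qed.

End Topology.

(** * Simple connectivity and cocycles *)

Section Holonomy.
Import Order.TTheory GRing.Theory Num.Theory.
Import numFieldNormedType.Exports.
Local Open Scope ring_scope.
Variables (R : realType) (V : choiceType) (K : scomplex V).
Local Notation "|K|" := (realization R K).
Local Notation E := (fun a b => K [fset a; b]%fset).
Local Notation F := (fun a b c => K [fset a; b; c]%fset).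

Definition supported_at (x : |K|) a := forall v, 0 < x v -> v = a.

Lemma supported_at_pos x a : supported_at x a -> 0 < x a.
Proof. by move=> xa; have [v xv] := realization_star x; rewrite -(xa v xv). Qed.

Lemma supported_at_inj x y a : supported_at x a -> supported_at y a -> x = y.
Proof.
have coordE (z : |K|) : supported_at z a -> forall v, z v = (v == a)%:R.
  move=> za v; have [s [_ sz s1]] := coord_supp z.
  have sE : s = [fset a]%fset.
    apply/fsetP => u; rewrite inE sz; apply/idP/eqP => [/za //|->].
    exact: supported_at_pos.
  have [->|va] := eqVneq v a; first by move: s1; rewrite sE big_seq_fset1.
  apply/eqP; rewrite eq_le coord_ge0 andbT leNgt; apply/negP => /za e.
  by rewrite e eqxx in va.
by move=> xa ya; apply: realization_eq => v; rewrite !coordE.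
Qed.

Lemma vertex_point a : K [fset a]%fset -> exists x : |K|, supported_at x a.
Proof.
move=> Ka; have [|||x xE] := @mk_point R V K [fset a]%fset (fun v => (v == a)%:R) Ka.
- by move=> v; rewrite ler0n.
- by move=> v; rewrite inE ltr0n; case: eqP.
- by rewrite big_seq_fset1 eqxx.
by exists x => v; rewrite xE ltr0n; case: eqP.
Qed.

(** In a subdivision into [N] intervals both ends of an interval are within [e] of
    its left end. *)
Lemma grid_ball (e : R) (N i i' : nat) : 0 < e -> (N%:R)^-1 < e -> (i < N)%N ->
  (i' == i) || (i' == i.+1) ->
  0 <= (i'%:R / N%:R : R) <= 1 /\ ball (i%:R / N%:R : R) e (i'%:R / N%:R).
Proof.
move=> e0 Ne iN ii'; have N0 : 0 < N%:R :> R by rewrite ltr0n (leq_trans _ iN).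
split.
  rewrite divr_ge0 ?ler0n //= ler_pdivrMr // mul1r ler_nat.
  by case/orP: ii' => /eqP -> //; exact: ltnW.
rewrite /ball /= -mulrBl normrM; case/orP: ii' => /eqP ->.
  by rewrite subrr normr0 mul0r.
rewrite -natr1 opprD addrA subrr add0r normrN normr1 mul1r.
by rewrite gtr0_norm // invr_gt0.
Qed.

Lemma small_inv (e : R) : 0 < e -> exists2 M, (0 < M)%N & (M%:R : R)^-1 < e.
Proof.
move=> e0; have [n _ /(_ n (leqnn n)) /= ne] := near_infty_natSinv_lt (PosNum e0).
by exists n.+1.
Qed.

(** Vertices whose open stars contain consecutive pieces of a path are adjacent,
    as both stars contain the common end point of the pieces. *)
Lemma path_connected_conn : path_connected R |K| ->
  forall a b, K [fset a]%fset -> K [fset b]%fset -> conn E a b.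
Proof.
move=> pc a b Ka Kb; have [[x xa] [y yb]] := (vertex_point Ka, vertex_point Kb).
have [f [cf f0 f1]] := pc x y.
have [e e0 eP] := lebesgue_star (segment_compact (a := 0) (b := 1)) cf.
have [N N0 Ne] := small_inv e0.
have /choice[v vP] : forall j, exists v, (j < N)%N ->
    forall j', (j' == j) || (j' == j.+1) -> 0 < f (j'%:R / N%:R) v.
  move=> j; have [jN|] := ltnP j N; last by exists a.
  have [|v vP] := eP (j%:R / N%:R).
    by rewrite /= in_itv /=; have [] := @grid_ball e N j j e0 Ne jN; rewrite ?eqxx.
  exists v => _ j' jj'; have [j'01 bj'] := grid_ball e0 Ne jN jj'.
  by apply: vP; rewrite //= in_itv.
have v0 : v 0%N = a.
  by apply: xa; have := vP 0%N N0 0%N isT; rewrite mul0r f0.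
have vN : v N.-1 = b.
  apply: yb; rewrite -f1; have : N%:R / N%:R = 1 :> R by rewrite divff // pnatr_eq0 -lt0n.
  by move=> <-; apply: vP; rewrite prednK // eqxx orbT.
rewrite -v0 -vN; have : (N.-1 < N)%N by rewrite prednK.
elim: N.-1 => [|j IH] jN; first exact: conn0.
apply: connS (IH (ltnW jN)) _.
apply: (@star_simplex _ _ _ (f (j.+1%:R / N%:R)) _ (v j)); first by rewrite !inE eqxx.
by move=> u; rewrite !inE => /orP[] /eqP ->; apply: vP; rewrite ?eqxx ?orbT // ltnW.
Qed.

Section Cocycle.
Local Open Scope group_scope.
Variables (P : groupType) (k : V -> V -> P).
Hypothesis kP : forall a b c, F a b c -> k b c * k a b = k a c.

(** The holonomy of the cocycle along the edge path [u 0, ..., u n]. *)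
Fixpoint hol (u : nat -> V) n : P :=
  if n is m.+1 then k (u m) (u m.+1) * hol u m else 1.

Lemma cocycle1 a : K [fset a]%fset -> k a a = 1.
Proof.
move=> Ka; apply: (@mulgI _ (k a a)); rewrite kP ?mulg1 //.
by rewrite !fsetUid.
Qed.

Lemma cocycleV a b : E a b -> k b a = (k a b)^-1.
Proof.
move=> Eab; apply: (@mulIg _ (k a b)); rewrite mulVg kP ?cocycle1 //.
  by apply: (simplex_face Eab); [exact: fsubsetUl | apply/fset0Pn; exists a; rewrite inE].
by rewrite fsetUC fsetUA fsetUid.
Qed.

Lemma star_cocycle (x : |K|) a b c : (0 < x a)%R -> (0 < x b)%R -> (0 < x c)%R ->
  k b c * k a b = k a c.
Proof.
move=> xa xb xc; apply: kP; apply: (@star_simplex _ _ _ x _ a) => [|v].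
  by rewrite !inE eqxx.
by rewrite !inE => /orP[/orP[]|] /eqP ->.
Qed.

(** A null homotopy of an edge loop, cut into squares each of which is mapped
    into an open star, shows that the cocycle has no holonomy along the loop:
    the four squares around a grid point span a simplex, so the products along
    two adjacent rows of squares agree. *)
Lemma hol_null (u : nat -> V) n : (0 < n)%N -> (forall i, (i < n)%N -> E (u i) (u i.+1)) ->
  u n = u 0%N ->
  (forall f : R -> |K|, continuous f -> f 0%R = f 1%R -> null_homotopic f) ->
  hol u n = 1.
Proof.
move=> n0 uE un nullP; have [g [gc gv ge]] := edge_path R n0 uE.
have n0R : (n%:R != 0 :> R)%R by rewrite pnatr_eq0 -lt0n.
pose f (t : R) := g (n%:R * t)%R.
have fc : continuous f.
  move=> t; apply: continuous_comp; last exact: gc.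
  by apply: cvgM; [exact: cvg_cst | exact: cvg_id].
have f0 : supported_at (f 0%R) (u 0%N).
  by move=> v; rewrite /f mulr0 => fv; apply: (gv 0%N v).
have f1 : supported_at (f 1%R) (u 0%N).
  by move=> v; rewrite /f mulr1 -un => fv; apply: (gv n v).
have [H [Hc H0 H1 Hs]] := nullP f fc (supported_at_inj f0 f1).
have cA : compact (`[0%R, 1%R]%classic `*` `[0%R, 1%R]%classic : set (R * R)).
  by apply: compact_setX; exact: segment_compact.
have [e e0 eP] := lebesgue_star cA Hc.
have [M M0 Me] := small_inv e0; pose N := (n * M)%N.
have N0 : (0 < N)%N by rewrite muln_gt0 n0.
have Ne : ((N%:R : R)^-1 < e)%R.
  apply: le_lt_trans Me; rewrite lef_pV2 ?posrE ?ltr0n // ler_nat.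
  by rewrite /N leq_pmull.
pose at_ (i j : nat) := H (i%:R / N%:R, j%:R / N%:R)%R.
have /choice[v vP] : forall ij : nat * nat, exists v, (ij.1 < N)%N -> (ij.2 < N)%N ->
    forall i' j', (i' == ij.1) || (i' == ij.1.+1) ->
      (j' == ij.2) || (j' == ij.2.+1) -> (0 < at_ i' j' v)%R.
  move=> [i j] /=; have [iN|] := ltnP i N; last by exists (u 0%N).
  have [jN|] := ltnP j N; last by exists (u 0%N).
  have [|v vP] := eP (i%:R / N%:R, j%:R / N%:R)%R.
    by split; rewrite /= in_itv /=; [have [] := @grid_ball e N i i e0 Ne iN|
      have [] := @grid_ball e N j j e0 Ne jN]; rewrite ?eqxx.
  exists v => _ _ i' j' ii' jj'.
  have [i'01 bi'] := grid_ball e0 Ne iN ii'; have [j'01 bj'] := grid_ball e0 Ne jN jj'.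
  by apply: vP; [split; rewrite /= in_itv | split].
have {}vP i j i' j' : (i < N)%N -> (j < N)%N -> (i' == i) || (i' == i.+1) ->
    (j' == j) || (j' == j.+1) -> (0 < at_ i' j' (v (i, j)))%R.
  by move=> iN jN; exact: (vP (i, j) iN jN).
have div1 : (N%:R / N%:R = 1 :> R)%R by rewrite divff // pnatr_eq0 -lt0n.
have div0 : (0%:R / N%:R = 0 :> R)%R by rewrite mul0r.
have unit_int i : (i <= N)%N -> (0 <= (i%:R / N%:R : R) <= 1)%R.
  by move=> iN; rewrite divr_ge0 //= ler_pdivrMr ?ltr0n // mul1r ler_nat.
have in01 i : (i <= N)%N -> (i%:R / N%:R : R)%R \in `[0, 1]%R.
  by move=> iN; rewrite in_itv /=; exact: unit_int.
have NK : N.-1.+1 = N by rewrite prednK.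
have vleft i : (i < N)%N -> v (i, 0%N) = u 0%N.
  move=> iN; apply: f0; have := vP i 0%N i 0%N iN N0; rewrite !eqxx => /(_ isT isT).
  by rewrite /at_ div0 (Hs _ (in01 _ (ltnW iN))).1.
have vright i : (i < N)%N -> v (i, N.-1) = u 0%N.
  move=> iN; apply: f0; have := vP i N.-1 i N iN; rewrite NK !eqxx orbT => /(_ _ isT isT).
  by rewrite /at_ div1 (Hs _ (in01 _ (ltnW iN))).2; apply.
have vlast j : (j < N)%N -> v (N.-1, j) = u 0%N.
  move=> jN; apply: f0; have := vP N.-1 j N j; rewrite NK !eqxx orbT => /(_ _ _ isT isT).
  by rewrite /at_ div1 (H1 _ (in01 _ (ltnW jN))); apply.
have Ku0 : K [fset u 0%N]%fset.
  apply: (simplex_face (uE _ n0)); [exact: fsubsetUl |].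
  by apply/fset0Pn; exists (u 0%N); rewrite inE.
pose row i := hol (fun j => v (i, j)).
have row_step i j : (i.+1 < N)%N -> (j < N)%N ->
    k (v (i, j)) (v (i.+1, j)) * row i j = row i.+1 j * k (v (i, 0%N)) (v (i.+1, 0%N)).
  move=> iN; elim: j => [|j IH] jN; first by rewrite mul1g mulg1.
  have iN' := ltnW iN; have jN' := ltnW jN.
  have p1 := vP i j i.+1 j.+1 iN' jN'; have p2 := vP i.+1 j i.+1 j.+1 iN jN'.
  have p3 := vP i j.+1 i.+1 j.+1 iN' jN; have p4 := vP i.+1 j.+1 i.+1 j.+1 iN jN.
  move: p1 p2 p3 p4; rewrite !eqxx !orbT.
  move=> /(_ isT isT) p1 /(_ isT isT) p2 /(_ isT isT) p3 /(_ isT isT) p4.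
  rewrite /row /= mulgA (star_cocycle p1 p3 p4) -(star_cocycle p1 p2 p4).
  by rewrite -mulgA IH // mulgA.
have row1 i : (i < N)%N -> row i N.-1 = row 0%N N.-1.
  elim: i => // i IH iN; rewrite -IH; last exact: ltnW.
  have := row_step i N.-1 iN; rewrite NK => /(_ (leqnn N)).
  rewrite !vleft ?vright ?cocycle1 ?mul1g ?mulg1 //; exact: ltnW.
have row_last j : (j < N)%N -> row N.-1 j = 1.
  elim: j => // j IH jN; rewrite /row /= -/(row _ _) IH ?mulg1; last exact: ltnW.
  by rewrite !vlast ?cocycle1 //; exact: ltnW.
(* the first row follows the loop f, with M squares for each of its edges *)
have time j : (n%:R * (j%:R / N%:R) = j%:R / M%:R :> R)%R.
  by rewrite /N natrM invfM mulrCA mulVKf.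
have at0 j : (j <= N)%N -> at_ 0%N j = g (j%:R / M%:R)%R.
  by move=> jN; rewrite /at_ div0 H0 ?in01 // /f time.
have M0R : (0 < M%:R :> R)%R by rewrite ltr0n.
(* the part of the first row up to column j is homotopic to the loop up to its
   last vertex before that time, followed by one edge *)
have row0 j : (j < N)%N ->
    k (u (j %/ M)%N) (v (0%N, j)) * hol u (j %/ M)%N = row 0%N j.
  elim: j => [|j IH] jN.
    by rewrite div0n vleft // cocycle1 // mulg1.
  have jN' := ltnW jN; rewrite /row /= -/(row _ _) -IH // mulgA.
  have := vP 0%N j 0%N j.+1 N0 jN'; rewrite !eqxx orbT => /(_ isT isT) p1.
  have := vP 0%N j.+1 0%N j.+1 N0 jN; rewrite !eqxx => /(_ isT isT) p2.
  rewrite at0 // in p1 p2; rewrite divnS //.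
  have jn : (j %/ M < n)%N by rewrite ltn_divLR.
  have [dvd|ndvd] := boolP (M %| j.+1)%N; last first.
    have js : ((j %/ M)%N%:R <= (j.+1%:R / M%:R : R) <= (j %/ M)%N.+1%:R)%R.
      rewrite ler_pdivlMr // ler_pdivrMr // -!natrM !ler_nat.
      by rewrite (leq_trans (leq_divM j M)) //= ltn_ceil.
    rewrite add0n; congr (_ * _).
    have uu := uE _ jn.
    have mem w : (0 < g (j.+1%:R / M%:R) w)%R -> w \in [fset u (j %/ M)%N; u (j %/ M)%N.+1]%fset.
      by move=> /(ge _ _ _ jn js)[] ->; rewrite !inE eqxx ?orbT.
    symmetry; apply: kP; apply: (simplex_face uu); last first.
      by apply/fset0Pn; exists (u (j %/ M)%N); rewrite !inE eqxx.
    apply/fsubsetP => w; rewrite !inE -!orbA => /or3P[] /eqP ->; rewrite ?eqxx //.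
      by have := mem _ p1; rewrite !inE.
    by have := mem _ p2; rewrite !inE.
  have e1 : (j.+1 %/ M)%N = (j %/ M)%N.+1 by rewrite divnS // dvd.
  have js : (j.+1%:R / M%:R = (j %/ M)%N.+1%:R :> R)%R.
    by rewrite -e1 -{1}(divnK dvd) natrM mulfK // lt0r_neq0.
  rewrite js in p1 p2; rewrite (gv _ _ _ p1) // (gv _ _ _ p2) // add1n /=.
  rewrite cocycle1 ?mul1g //.
  apply: (simplex_face (uE _ jn)); [exact: fsubsetUr |].
  by apply/fset0Pn; exists (u (j %/ M)%N.+1); rewrite inE.
have := row0 N.-1; rewrite NK => /(_ (leqnn _)).
have -> : (N.-1 %/ M = n.-1)%N.
  have -> : N.-1 = (n.-1 * M + M.-1)%N.
    by rewrite /N -{1}(prednK n0) mulSn addnC -subn1 -addnBA // subn1.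
  by rewrite divnMDl // divn_small ?addn0 // prednK.
rewrite -(row1 N.-1) ?NK // row_last ?NK // vright // -un; by case: (n) n0.
Qed.

(** [hpath a b z] means that some edge path from [a] to [b] has holonomy [z]. *)
Inductive hpath a : V -> P -> Prop :=
| hpath0 : hpath a a 1
| hpathS b c z : hpath a b z -> E b c -> hpath a c (k b c * z).

Lemma hpath_trans a b c y z : hpath a b z -> hpath b c y -> hpath a c (y * z).
Proof.
move=> ab; elim=> [|d e w _ IH de]; first by rewrite mul1g.
by rewrite -mulgA; exact: hpathS.
Qed.

Lemma hpath_sym a b z : hpath a b z -> hpath b a z^-1.
Proof.
elim=> [|c d y _ ca cd]; first by rewrite invg1; exact: hpath0.
have dc : E d c by rewrite fsetUC.
rewrite invgM -cocycleV // -[k d c]mulg1.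
exact: hpath_trans (hpathS (hpath0 d) dc) ca.
Qed.

Lemma hpath_conn a b : conn E a b -> exists z, hpath a b z.
Proof.
elim=> [|c d _ [z az] cd]; first by exists 1; exact: hpath0.
by exists (k c d * z); exact: hpathS.
Qed.

Lemma hpath_hol a b z : hpath a b z -> exists u n,
  [/\ u 0%N = a, u n = b, forall i, (i < n)%N -> E (u i) (u i.+1) & hol u n = z].
Proof.
elim=> [|c d y _ [u [n [u0 un uE uh]]] cd]; first by exists (fun=> a), 0%N.
pose w i := if (i <= n)%N then u i else d.
have wu i : (i <= n)%N -> w i = u i by rewrite /w => ->.
have wn : w n.+1 = d by rewrite /w ltnn.
exists w, n.+1; split=> //.
  move=> i; rewrite ltnS leq_eqVlt => /orP[/eqP ->|ilt].
    by rewrite wn wu // un.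
  by rewrite (wu _ (ltnW ilt)) (wu _ ilt); exact: uE.
have -> : hol w n.+1 = k (w n) (w n.+1) * hol w n by [].
rewrite wn wu // un -uh; congr (_ * _).
suff holE m : (m <= n)%N -> hol w m = hol u m by exact: holE.
by elim: m => //= m IH mn; rewrite (IH (ltnW mn)) (wu _ mn) (wu _ (ltnW mn)).
Qed.

End Cocycle.

(** Integrating a cocycle along edge paths from a base point in each component
    exhibits it as a coboundary, since loops have no holonomy. *)
Lemma cocycle_trivial_of_null :
  (forall f : R -> |K|, continuous f -> f 0 = f 1 -> null_homotopic f) ->
  cocycle_trivial E F.
Proof.
move=> nullP P k kP.
have loop1 a z : hpath k a a z -> z = 1%g.
  move=> /hpath_hol[u [[|n] [u0 un uE <-]]] //.
  by apply: hol_null => //; rewrite un u0.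
have uniq_hol a b y z : hpath k a b y -> hpath k a b z -> y = z.
  move=> ay az; have /loop1 := hpath_trans az (hpath_sym kP ay).
  by move/mulg1_eq; rewrite invgK.
case: (pselect (inhabited V)) => [[a0]|noV]; last first.
  by exists (fun=> 1%g) => a; case: noV.
have Esym a b : E a b -> E b a by rewrite fsetUC.
pose base a := xget a0 [set b | conn E a b].
have baseP a : conn E a (base a).
  by apply: (@xgetPex _ a0 [set b | conn E a b]); exists a; exact: conn0.
have baseE a b : E a b -> base a = base b.
  move=> ab; rewrite /base; congr xget; apply/seteqP; split=> c.
    exact: conn_trans (conn1 (Esym _ _ ab)).
  exact: conn_trans (conn1 ab).
pose c a := xget 1%g [set z | hpath k (base a) a z].
have cP a : hpath k (base a) a (c a).
  apply: (@xgetPex _ 1%g [set z | hpath k (base a) a z]).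
  exact: hpath_conn (conn_sym Esym (baseP a)).
exists c => a b ab; have bb := cP b; rewrite -(baseE _ _ ab) in bb.
by rewrite -(uniq_hol _ _ _ _ (hpathS (cP a) ab) bb) mulgK.
Qed.

End Holonomy.

Section ComponentLoops.
Import Order.TTheory GRing.Theory Num.Theory.
Import numFieldNormedType.Exports.
Local Open Scope ring_scope.
Variables (R : realType).

(** A loop, being connected, lies in one connected component. *)
Lemma component_null (T : topologicalType) :
  (forall x : T, simply_connected R (set_type (connected_component setT x))) ->
  forall f : R -> T, continuous f -> f 0 = f 1 -> null_homotopic f.
Proof.
move=> scP f cf f01; pose C := connected_component setT (f 0).
have fC t : C (f t).
  have B : [set f u | u in setT] `<=` C.
    apply: connected_component_max; [by exists 0|by []|].
    apply: connected_continuous_connected; last exact: continuous_subspaceT.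
    by apply/connected_intervalP => x y _ _ z _.
  by apply: B; exists t.
pose f' t : set_type C := SigSub (mem_set (fC t)).
have cf' : continuous f' by apply: continuous_comp_initial.
have [_ _ nullP] := scP (f 0).
have [||H [cH H0 H1 Hs]] := nullP f'.
- exact: continuous_subspaceT.
- exact: val_inj.
exists (set_val \o H); split.
- have /subspace_continuousP cH' := cH.
  apply/subspace_continuousP => x Ax.
  apply: (@cvg_comp _ _ _ H set_val _ (nbhs (H x))); first exact: cH'.
  exact: (@initial_continuous C T set_val).
- by move=> t t01; rewrite /= H0.
- by move=> t t01; rewrite /= H1.
- by move=> s s01; have [h0 h1] := Hs s s01; rewrite /= h0 h1.
Qed.

End ComponentLoops.

(** * The simplicial action *)

Section Action.
Import Order.TTheory GRing.Theory Num.Theory.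
Import numFieldNormedType.Exports.
Local Open Scope ring_scope.
Variables (R : realType) (G : groupType) (V : choiceType).
Variable X : simplicialGCW R G V.
Local Notation "|X|" := (realization R X).

Lemma open_cell_ne s : X s -> exists x : |X|, open_cell s x.
Proof.
move=> Ks; have s0 : (0 < #|` s|)%N by rewrite cardfs_gt0; exact: simplex_neq0 Ks.
have s0R : 0 < (#|` s|%:R : R)^-1 by rewrite invr_gt0 ltr0n.
pose c v : R := if v \in s then (#|` s|%:R)^-1 else 0.
have [|||x xE] := @mk_point R V X s c Ks.
- by move=> v; rewrite /c; case: ifP => // _; exact: ltW.
- by move=> v; rewrite /c; case: ifP; rewrite ?ltxx.
- rewrite (eq_big_seq (fun=> (#|` s|%:R)^-1)) => [|v vs]; last by rewrite /c vs.
  rewrite big_const_seq count_predT iter_addr_0 -[X in X *+ _]mul1r -mulrnAl.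
  by rewrite divff // pnatr_eq0 -lt0n.
by exists x => v; rewrite xE /c; case: ifP; rewrite ?s0R ?ltxx.
Qed.

Lemma open_cell_inj s t (x : |X|) : open_cell s x -> open_cell t x -> s = t.
Proof. by move=> sx tx; apply/fsetP => v; rewrite sx tx. Qed.

Lemma cell_of (x : |X|) : exists2 s, X s & open_cell s x.
Proof. by have [s [Ks sx _]] := coord_supp x; exists s. Qed.

Lemma closed_cell_sum s (x : |X|) : closed_cell s x -> \sum_(v <- s) x v = 1.
Proof.
move=> sx; have [t [_ tx t1]] := coord_supp x.
rewrite -t1 (big_fsetID _ (mem t)) /= [X in _ + X]big1_fset ?addr0; last first.
  move=> v; rewrite !inE => /andP[_ vt] _.
  by apply/eqP; rewrite eq_le coord_ge0 andbT leNgt -tx.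
apply: eq_fbigl => v; rewrite !inE andb_idl // tx; exact: sx.
Qed.

(** An open cell is dense in its closed cell: points of the segment from [y] to a
    point [b] of the open cell belong to the latter and come close to [y]. *)
Lemma closed_cell_zero s (phi : |X| -> R) : X s -> continuous phi ->
  (forall x, open_cell s x -> phi x = 0) -> forall y, closed_cell s y -> phi y = 0.
Proof.
move=> Ks cphi phi0 y ys; apply: contrapT => /eqP phiy.
have /open_weakE oU : open (phi @^-1` [set r | r != 0]).
  by have /continuousP := cphi; apply; exact: open_neq.
have [e e0 eU] := oU s Ks y ys phiy.
have [b bs] := open_cell_ne Ks.
have bcs : closed_cell s b by move=> v; rewrite bs.
pose D := \sum_(v <- s) `|y v - b v|.
have D0 : 0 <= D by exact: sumr_ge0.
pose t := e / (e + D + 1).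
have ED : 0 < e + D + 1 by lra.
have t0 : 0 < t by rewrite divr_gt0.
have t1 : t < 1 by rewrite ltr_pdivrMr //; lra.
pose c v := (1 - t) * y v + t * b v.
have [|||z zE] := @mk_point R V X s c Ks.
- by move=> v; rewrite addr_ge0 // mulr_ge0 ?coord_ge0 //; lra.
- move=> v cv; apply: contrapT => /negP vs; move: cv.
  by rewrite /c !(closed_cell_out _ vs) // !mulr0 addr0 ltxx.
- by rewrite big_split /= -!mulr_sumr !closed_cell_sum //; lra.
have zs : open_cell s z.
  move=> v; apply/idP/idP => [vs|].
    rewrite zE ltr_wpDl // ?mulr_ge0 ?coord_ge0 //; first by lra.
    by rewrite mulr_gt0 // -bs.
  rewrite zE => zv; apply: contrapT => /negP vs; move: zv.
  by rewrite /c !(closed_cell_out _ vs) // !mulr0 addr0 ltxx.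
suff : phi z != 0 by rewrite phi0 // eqxx.
apply: eU => [v|v vs]; first by rewrite zs.
rewrite zE /c; have -> : y v - ((1 - t) * y v + t * b v) = t * (y v - b v) by ring.
rewrite normrM gtr0_norm //.
have : `|y v - b v| <= D.
  by rewrite /D (big_fsetD1 v) //= lerDl; apply: sumr_ge0.
move=> yD; apply: le_lt_trans (ler_wpM2l (ltW t0) yD) _.
by rewrite /t mulrAC ltr_pdivrMr // ltr_pM2l //; lra.
Qed.

Definition cell g s := xget s [set t | X t /\ act X g @` open_cell s = open_cell t].

Lemma cellP g s : X s -> X (cell g s) /\ act X g @` open_cell s = open_cell (cell g s).
Proof.
move=> Ks; have [t Kt e] := act_cell g Ks.
by apply: (@xgetPex _ s [set t | X t /\ act X g @` open_cell s = open_cell t]); exists t.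
Qed.

Lemma cell_simplex g s : X s -> X (cell g s).
Proof. by move=> /(cellP g)[]. Qed.

Lemma cell_act g s x : X s -> open_cell s x -> open_cell (cell g s) (act X g x).
Proof. by move=> Ks sx; rewrite -(cellP g Ks).2; exists x. Qed.

Lemma cell_unique g s t x : X s -> open_cell s x -> open_cell t (act X g x) ->
  cell g s = t.
Proof. by move=> Ks sx; apply: open_cell_inj; exact: cell_act. Qed.

Lemma cell1 s : X s -> cell 1 s = s.
Proof.
move=> Ks; have [x xs] := open_cell_ne Ks.
by apply: (cell_unique Ks xs); rewrite act1.
Qed.

Lemma cellM g h s : X s -> cell (g * h)%g s = cell g (cell h s).
Proof.
move=> Ks; have [x xs] := open_cell_ne Ks; apply: (cell_unique Ks xs).
by rewrite actM; do 2?apply: cell_act => //; exact: cell_simplex.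
Qed.

Lemma cellVK g s : X s -> cell g^-1%g (cell g s) = s.
Proof. by move=> Ks; rewrite -cellM // mulVg cell1. Qed.

Lemma cellKV g s : X s -> cell g (cell g^-1%g s) = s.
Proof. by move=> Ks; rewrite -cellM // mulgV cell1. Qed.

Lemma act_coord_continuous g v : continuous (fun x => act X g x v : R).
Proof.
move=> x; apply: (@continuous_comp _ _ _ (act X g) (fun y : |X| => y v : R)).
  exact: act_continuous.
exact: coord_continuous.
Qed.

(** A homeomorphism maps the closure of a cell to the closure of its image:
    coordinates that vanish on the image of the open cell vanish on the image of
    its faces. *)
Lemma cell_face g s t : X s -> (t `<=` s)%fset -> t != fset0 ->
  (cell g t `<=` cell g s)%fset.
Proof.
move=> Ks ts t0; have Kt := simplex_face Ks ts t0.
have [x xt] := open_cell_ne Kt; have gx := cell_act g Kt xt.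
apply/fsubsetP => v; rewrite gx; apply: contraLR => vs; rewrite -leNgt.
suff -> : act X g x v = 0 by [].
apply: (closed_cell_zero Ks (@act_coord_continuous g v)) => [z zs|u].
  apply/eqP; rewrite eq_le coord_ge0 andbT leNgt.
  by rewrite -(cell_act g Ks zs).
by rewrite -xt; exact: (fsubsetP ts).
Qed.

Lemma vertex_simplex s v : X s -> v \in s -> X [fset v]%fset.
Proof.
move=> Ks vs; apply: (simplex_face Ks); first by rewrite fsub1set.
by apply/fset0Pn; exists v; rewrite inE.
Qed.

(** By [cell_face] the action preserves inclusion of cells in both directions, so
    it preserves minimal cells. *)
Lemma cell_vertex g v : X [fset v]%fset -> exists u, cell g [fset v]%fset = [fset u]%fset.
Proof.
move=> Kv; have Kgv := cell_simplex g Kv.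
have /fset0Pn[u ugv] := simplex_neq0 Kgv; have Ku := vertex_simplex Kgv ugv.
exists u; have : cell g^-1%g [fset u]%fset = [fset v]%fset.
  apply/eqP; rewrite eqEfcard cardfs1 cardfs_gt0 (simplex_neq0 (cell_simplex _ Ku)) andbT.
  rewrite -(cellVK g Kv); apply: cell_face => //; first by rewrite fsub1set.
  exact: simplex_neq0 Ku.
by move=> <-; rewrite cellKV.
Qed.

(** Elements of [V] that are not vertices are fixed, so that this is an action on
    all of [V]. *)
Definition vact g v := xget v [set u | X [fset v]%fset /\ cell g [fset v]%fset = [fset u]%fset].

Lemma vactP g v : X [fset v]%fset -> cell g [fset v]%fset = [fset vact g v]%fset.
Proof.
move=> Kv; have [u uE] := cell_vertex g Kv.
suff [] : [set u | X [fset v]%fset /\ cell g [fset v]%fset = [fset u]%fset] (vact g v) by [].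
by apply: xgetPex; exists u.
Qed.

Lemma vact_out g v : ~ X [fset v]%fset -> vact g v = v.
Proof. by move=> nKv; rewrite /vact xgetPN // => u []. Qed.

Lemma vact_vertex g v : X [fset v]%fset -> X [fset vact g v]%fset.
Proof. by move=> Kv; rewrite -vactP //; exact: cell_simplex. Qed.

Lemma vact_action : is_action vact.
Proof.
split=> [v|g h v]; (have [Kv|nKv] := pselect (X [fset v]%fset); last by rewrite !vact_out).
  by apply: fset1_inj; rewrite -vactP // cell1.
apply: fset1_inj; rewrite -(vactP _ Kv) -(vactP _ (vact_vertex h Kv)).
by rewrite -(vactP h Kv) cellM.
Qed.

Lemma cell_image g s : X s -> cell g s = [fset vact g x | x in s]%fset.
Proof.
move=> Ks; apply/fsetP => u; apply/idP/imfsetP => [us|[v /= vs ->]].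
  have Ku := vertex_simplex (cell_simplex g Ks) us.
  exists (vact g^-1%g u); last by rewrite (action_KV g vact_action).
  rewrite /= -fsub1set -vactP // -(cellVK g Ks); apply: cell_face.
  - exact: cell_simplex.
  - by rewrite fsub1set.
  - exact: simplex_neq0 Ku.
have Kv := vertex_simplex Ks vs; rewrite -fsub1set -vactP //; apply: cell_face => //.
  by rewrite fsub1set.
exact: simplex_neq0 Kv.
Qed.

(** An element preserving an open cell fixes it pointwise, hence by density it
    also fixes the vertices of the cell. *)
Lemma stabiliserE s g : X s -> stabiliser X s g <-> forall v, v \in s -> vact g v = v.
Proof.
move=> Ks; split=> [gs v vs|gs]; last first.
  rewrite /stabiliser /= (cellP g Ks).2 cell_image //.
  congr open_cell; rewrite -[RHS]imfset_id; apply: eq_in_imfset => //.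
have Kv := vertex_simplex Ks vs; have [p pv] := open_cell_ne Kv.
suff gp : act X g p = p.
  by apply: fset1_inj; rewrite -vactP //; apply: (cell_unique Kv pv); rewrite gp.
apply: realization_eq => w; apply/eqP; rewrite -subr_eq0; apply/eqP.
apply: (@closed_cell_zero s (fun z => act X g z w - z w) Ks).
- by move=> z; exact: (cvgB (@act_coord_continuous g w z) (@coord_continuous R V X w z)).
- by move=> z zs; rewrite (act_fix Ks gs) // subrr.
- by move=> u; rewrite -pv inE => /eqP ->.
Qed.

(** The points are translates of points chosen in representatives of the orbits of
    cells; they are well defined because the stabiliser of a cell fixes it
    pointwise. *)
Lemma equivariant_points (x0 : |X|) : exists pt : {fset V} -> |X|,
  (forall s, X s -> open_cell s (pt s)) /\
  (forall g s, X s -> act X g (pt s) = pt (cell g s)).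
Proof.
have /choice[p pP] : forall s, exists x : |X|, X s -> open_cell s x.
  move=> s; have [/open_cell_ne[x xs]|nKs] := pselect (X s); first by exists x.
  by exists x0.
pose orb s := [set t | X t /\ exists g, s = cell g t].
pose rep s := xget fset0 (orb s).
have repP s : X s -> X (rep s) /\ exists g, s = cell g (rep s).
  by move=> Ks; apply: (@xgetPex _ fset0 (orb s)); exists s; split=> //; exists 1%g; rewrite cell1.
have repE g s : X s -> rep (cell g s) = rep s.
  move=> Ks; rewrite /rep; congr xget; apply/seteqP; split=> t [Kt [h e]]; split=> //.
    by exists (g^-1 * h)%g; rewrite cellM // -e cellVK.
  by exists (g * h)%g; rewrite cellM // -e.
pose h s := xget 1%g [set g | s = cell g (rep s)].
have hP s : X s -> cell (h s) (rep s) = s.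
  by move=> /repP[_ rs]; symmetry; exact: (@xgetPex _ 1%g [set g | s = cell g (rep s)]).
exists (fun s => act X (h s) (p (rep s))); split=> [s Ks|g s Ks].
  by rewrite -[X in open_cell X _](hP s Ks); apply: cell_act; [|apply: pP]; case: (repP s Ks).
have [Kr _] := repP s Ks; have Kgs := cell_simplex g Ks.
rewrite repE //; set r := rep s in Kr *; set k := h (cell g s).
have e1 : cell k r = cell g s by rewrite /k /r -(repE g s Ks) hP.
have fixr : act X (k^-1 * (g * h s))%g @` open_cell r = open_cell r.
  by rewrite (cellP _ Kr).2 !cellM // -/r hP // -e1 cellVK.
have := act_fix Kr fixr (pP _ Kr); rewrite actM => e.
by rewrite -[in RHS]e -!actM mulgA mulgV mul1g.
Qed.

(** A closed cell contains only finitely many of the points [pt t], namely those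
    with [t] a face of the cell. *)
Lemma off_points_open (pt : {fset V} -> |X|) (B : {fset V} -> Prop) :
  (forall s, X s -> open_cell s (pt s)) ->
  open [set x : |X| | forall t, X t -> B t -> x <> pt t].
Proof.
move=> ptP; apply/open_weakE => s Ks x xs Ux.
suff [e e0 eP] : exists2 e : R, 0 < e & forall t, t \in fpowerset s -> X t -> B t ->
    forall y : |X|, (forall v, v \in s -> `|x v - y v| < e) -> y <> pt t.
  exists e => // y ys xy t Kt Bt e1; apply: (eP t _ Kt Bt y xy e1).
  rewrite fpowersetE; apply/fsubsetP => v; rewrite (ptP _ Kt) -e1; exact: ys.
suff all_q (q : seq {fset V}) : (forall t, t \in q -> (t `<=` s)%fset) ->
    exists2 e : R, 0 < e & forall t, t \in q -> X t -> B t ->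
    forall y : |X|, (forall v, v \in s -> `|x v - y v| < e) -> y <> pt t.
  by apply: all_q => t; rewrite fpowersetE.
elim: q => [|t q IH] qs; first by exists 1 => // t; rewrite in_nil.
have [|e e0 eP] := IH; first by move=> u uq; apply: qs; rewrite inE uq orbT.
have [[Kt Bt]|nt] := pselect (X t /\ B t); last first.
  exists e => // u; rewrite inE => /orP[/eqP -> Kt Bt|]; last exact: eP.
  by case: nt.
have ts : (t `<=` s)%fset by apply: qs; rewrite inE eqxx.
have [v [vs xv]] : exists v, v \in s /\ x v != pt t v.
  apply: contrapT => h; apply: (Ux t Kt Bt); apply: realization_eq => v.
  have [vs|vs] := boolP (v \in s).
    by apply: contrapT => /eqP xv; apply: h; exists v.
  rewrite !(closed_cell_out _ vs) // => u; rewrite -(ptP _ Kt); exact: (fsubsetP ts).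
exists (Num.min e `|x v - pt t v|).
  by rewrite lt_min e0 normr_gt0 subr_eq0.
move=> u; rewrite inE => /orP[/eqP -> _ _ y xy|uq Ku Bu y xy].
  by move=> e1; have := xy v vs; rewrite e1 lt_min ltxx andbF.
by apply: (eP u uq Ku Bu) => w /xy; rewrite lt_min => /andP[].
Qed.

(** Removing from the realization the chosen points outside of the orbit of a cell
    [s] leaves an open set [U s]. These sets cover the skeleton and are invariant,
    and the chosen point of a cell belongs to [U s] only if the cell is in the
    orbit of [s]; so finitely many of them cover only if there are finitely many
    orbits. *)
Lemma finite_orbits k (x0 : |X|) : cocompact X (skeleton X k) ->
  exists pts : seq V, forall s, X s -> (#|` s|%fset <= k.+1)%N ->
    exists g, forall x, x \in s -> vact g x \in pts.
Proof.
move=> cc; have [pt [ptP ptG]] := equivariant_points x0.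
pose orb s t := exists g, t = cell g s.
pose U s := [set x : |X| | forall t, X t -> ~ orb s t -> x <> pt t].
have Uopen s : open (U s) by exact: off_points_open.
have UG s g x : X s -> U s x -> U s (act X g x).
  move=> Ks Ux t Kt nst e; have Kgt := cell_simplex g^-1%g Kt.
  apply: (Ux _ Kgt); last by rewrite -ptG // -e -actM mulVg act1.
  by move=> [h e']; apply: nst; exists (g * h)%g; rewrite cellM // -e' cellKV.
pose D := [set s | X s /\ (#|` s|%fset <= k.+1)%N].
have skel s x : D s -> open_cell s x -> skeleton X k x by exists s.
pose Q := orbit_space X (skeleton X k).
pose f (s : {fset V}) : set Q := [set q | U s (set_val (repr q))].
have fE s (a : skeleton X k) : X s -> f s (\pi_Q a)%qT <-> U s (set_val a).
  move=> Ks; rewrite /f /=.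
  have : orbit_rel (repr (\pi_Q a)%qT) a by apply/eqmodP; rewrite reprK.
  move=> /asboolP[g <-]; split; first exact: UG.
  by move=> /(UG _ g^-1%g _ Ks); rewrite -actM mulVg act1.
have fopen s : D s -> open (f s).
  move=> [Ks _]; rewrite /open /=; exists (U s) => //.
  by apply/seteqP; split=> a; rewrite /= (fE s a Ks).
have [q0 _] : exists q0 : Q, True.
  have [s Ks sx] := cell_of x0; have [v vs] := fset0Pn _ (simplex_neq0 Ks).
  have Kv := vertex_simplex Ks vs.
  have sk : skeleton X k (pt [fset v]%fset).
    by apply: skel (ptP _ Kv); rewrite /D /= cardfs1.
  by exists (\pi_Q (SigSub (mem_set sk) : skeleton X k))%qT.
(* a base point, for the characterisation of compactness by finite subcovers *)
pose Qt : topologicalType := Q.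
pose Qp : ptopologicalType :=
  HB.pack (Topological.sort Qt) (isPointed.Build (Topological.sort Qt) q0).
have : @cover_compact Qp setT by rewrite -compact_cover; exact: cc.
move=> /(_ _ D f fopen)[].
  move=> q _; have [s [Ks sk] sx] := set_valP (repr (q : Q)).
  exists s => // t Kt nst e; apply: nst.
  have -> : t = s by apply: (open_cell_inj (ptP t Kt)); rewrite -e.
  by exists 1%g; rewrite cell1.
move=> D' D'D cov; exists (flatten [seq enum_fset s | s <- enum_fset D']) => s Ks sk.
have skx : skeleton X k (pt s) by exists s => //; exact: ptP.
pose a : skeleton X k := SigSub (mem_set skx).
have [s' s'D'] := cov (\pi_Q a)%qT I; have [Ks' _] := set_mem (D'D s' s'D').
move=> /(fE s' a Ks') Us.
have [g sE] : orb s' s by apply: contrapT => ns; exact: (Us s Ks ns).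
exists g^-1%g => x xs; apply/flattenP; exists (enum_fset s'); first exact: map_f.
have : vact g^-1%g x \in cell g^-1%g s by rewrite cell_image //; apply/imfsetP; exists x.
by rewrite sE cellVK.
Qed.

End Action.

Theorem proposition3p4 (R : realType) (G : groupType) (V : choiceType)
    (X : simplicialGCW R G V)
    (hX : simply_connected R (realization R X))
    (hcocompact : cocompact X (skeleton X 3))
    (hstab2 : forall s : {fset V}, X s -> #|` s|%fset = 3%N ->
      finitely_generated (stabiliser X s))
    (hstab1 : forall s : {fset V}, X s -> #|` s|%fset = 2%N ->
      finitely_presented (stabiliser X s))
    (hlink : forall v : V, X [fset v]%fset ->
      forall x : realization R (link X v),
        simply_connected R (set_type (connected_component setT x)))
    (hG : finitely_presented [set: G]) :
  forall v : V, X [fset v]%fset -> finitely_presented (stabiliser X [fset v]%fset).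
Proof.
move=> v Xv; have [[x0 _] Xpath Xnull] := hX.
have [pts ptsP] := finite_orbits x0 hcocompact.
have XE : finitely_presented [set g | vact X g v = v].
  apply: (vertex_stab_fp (K := X) (vact_action X) _ ptsP) => //.
  - by move=> g s Xs; rewrite -cell_image //; exact: cell_simplex.
  - move=> g; apply: (path_connected_conn Xpath) => //; exact: vact_vertex.
  - apply: (@cocycle_trivial_of_null R) => f cf f01; apply: Xnull => //.
    exact: continuous_subspaceT.
  - by apply: (@cocycle_trivial_of_null R); exact: (component_null (hlink v Xv)).
  - move=> a b ab Xab; have := hstab1 _ Xab; rewrite cardfs2 ab => /(_ erefl).
    congr finitely_presented; apply/seteqP; split=> g; rewrite stabiliserE //=.
      by move=> h; split; apply: h; rewrite !inE eqxx ?orbT.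
    by move=> [ga gb] x; rewrite !inE => /orP[] /eqP ->.
  - move=> a b c /= /and3P[]; rewrite !inE negb_or => /andP[ab ac] bc _ Xabc.
    have := hstab2 _ Xabc; rewrite fsetUC cardfsU1 cardfs2 ab !inE.
    rewrite ![c == _]eq_sym (negbTE ac) (negbTE bc) fsetUC => /(_ erefl).
    congr finitely_generated; apply/seteqP; split=> g; rewrite stabiliserE //=.
      by move=> h; split; apply: h; rewrite !inE eqxx ?orbT.
    by move=> [ga gb gc] x; rewrite !inE => /orP[/orP[]|] /eqP ->.
move: XE; congr finitely_presented; apply/seteqP; split=> g; rewrite stabiliserE //=.
  by move=> gv x; rewrite inE => /eqP ->.
by apply; rewrite inE eqxx.
Qed.
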